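(* Let $\mathbb{G}_{1},\mathbb{G}_{2}$ be two compact quantum groups. Assume that $\Phi:\mathrm{Rep}(\mathbb{G}_{1})\to\mathrm{Rep}(\mathbb{G}_{2})$ is an injective map preserving the fusion rules, that is, $$\Phi(\pi\otimes\pi')=\Phi(\pi)\otimes \Phi(\pi'),\quad \Phi(\oplus_{i=1}^n\pi_i)=\oplus_{i=1}^n\Phi(\pi_i), \quad \pi,\pi',\pi_i\in \mathrm{Rep}(\mathbb G_1),\ n\geq 1.$$ Then for any finite sequence $(c_{\pi})\subset\mathbb{C}$ and $x=\sum_{\pi\in\mathrm{Irr}(\mathbb{G}_{1})}c_{\pi}\chi_{\pi}\in\mathrm{Pol}(\mathbb{G}_{1})$, we have $$\Big\|\sum_{\pi\in\mathrm{Irr}(\mathbb{G}_{1})}c_{\pi}\chi_{\pi}\Big\|_{L^{\infty}(\mathbb{G}_{1})}=\Big\|\sum_{\pi\in\mathrm{Irr}(\mathbb{G}_{1})}c_{\pi}\chi_{\Phi(\pi)}\Big\|_{L^{\infty}(\mathbb{G}_{2})}.$$ Consequently, for any central Sidon set $\mathbf{E}\subset\mathrm{Irr}(\mathbb{G}_{1})$, if additionally there exists $C>0$ satisfying $\dim(\Phi(\pi))\leq C\dim(\pi)$ for all $\pi\in\mathbf{E}$, then $\Phi(\mathbf{E})\subset\mathrm{Irr}(\mathbb{G}_{2})$ is a central Sidon set for $\mathbb{G}_{2}$.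
   Context: For a compact quantum group $\mathbb G$ (Woronowicz) with Haar state $h$, $\mathrm{Rep}(\mathbb G)$ (resp. $\mathrm{Irr}(\mathbb G)$) is the set of unitary equivalence classes of finite-dimensional (resp. irreducible finite-dimensional) unitary representations; for $\pi$ with representative $u^{(\pi)}=[u^{(\pi)}_{ij}]\in C(\mathbb G)\otimes B(H_\pi)$, $\dim(\pi)=\dim H_\pi$ and $\chi_\pi=\sum_iu_{ii}^{(\pi)}$ is its character. $\pi\otimes\pi'$ is the tensor product representation, with coefficients $u^{(\pi)}_{ij}u^{(\pi')}_{kl}$. $\mathrm{Pol}(\mathbb G)$ is the span of the coefficients of irreducible representations and $L^\infty(\mathbb G)$ is the von Neumann algebra generated by $\mathrm{Pol}(\mathbb G)$ in the GNS representation of $h$, with norm $\|\cdot\|_\infty$. $Q_\pi$ ($\pi\in\mathrm{Irr}(\mathbb G)$) is the unique positive invertible operator on $H_\pi$ with $d_\pi:=\mathrm{Tr}(Q_\pi)=\mathrm{Tr}(Q_\pi^{-1})$ and $h((u_{ij}^{(\pi)})^*u_{lm}^{(\pi)})=\delta_{jm}(Q_\pi^{-1})_{li}/d_\pi$; $\hat x(\pi)=(h(\cdot\,x)\otimes\iota)((u^{(\pi)})^* )$ and $\|\hat x\|_1=\sum_{\pi\in\mathrm{Irr}(\mathbb G)} d_\pi\mathrm{Tr}(|\hat x(\pi)Q_\pi|)$. For $x=\sum_\pi c_\pi\chi_\pi$ this gives $\|\hat x\|_1=\sum_\pi\dim(\pi)|c_\pi|$. $\mathbf E\subset\mathrm{Irr}(\mathbb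 G)$ is a central Sidon set if there is $K>0$ such that $\|\hat x\|_1\le K\|x\|_\infty$ for every finite combination $x=\sum_{\pi\in\mathbf E}c_\pi\chi_\pi$, $c_\pi\in\mathbb C$.
   Formalization: The formal theorem additionally assumes that Φ maps Irr(G₁) into Irr(G₂); without it the claim fails, e.g. for restriction Rep(O₃⁺)→Rep(O₃), where the fundamental character has norm 2 in L∞(O₃⁺) but 3 in L∞(O₃). *)

(* Defs.v *)
From HB Require Import structures.
From mathcomp Require Import all_boot all_order all_algebra generic_quotient.
From mathcomp Require Import sesquilinear spectral complex mxtens.
From mathcomp Require Import all_classical all_reals all_analysis.

Set Implicit Arguments.
Unset Strict Implicit.
Unset Printing Implicit Defensive.

Import Order.TTheory GRing.Theory Num.Theory.
Local Open Scope classical_set_scope.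
Local Open Scope ring_scope.
Local Open Scope quotient_scope.
Local Open Scope sesquilinear_scope.

(* A unital C*-algebra.  The norm is kept real-valued: MathComp-Analysis would
   give a normed module over R[i] a norm with values in R[i], and has no join of
   rings and normed modules. *)
HB.mixin Record isCStar (R : realType) A of GRing.Algebra R[i] A := {
  star : A -> A ;
  cnorm : A -> R ;
  starD : forall a b, star (a + b) = star a + star b ;
  starZ : forall (c : R[i]) a, star (c *: a) = c^* *: star a ;
  starM : forall a b, star (a * b) = star b * star a ;
  starK : involutive star ;
  cnorm0_eq0 : forall a, cnorm a = 0 -> a = 0 ;
  ler_cnormD : forall a b, cnorm (a + b) <= cnorm a + cnorm b ;
  cnormZ : forall (c : R[i]) a, cnorm (c *: a) = complex.Re `|c| * cnorm a ;
  ler_cnormM : forall a b, cnorm (a * b) <= cnorm a * cnorm b ;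
  cnorm_starM : forall a, cnorm (star a * a) = cnorm a ^+ 2 ;
  cnorm_complete : forall u : nat -> A,
    (forall e : R, 0 < e -> exists N : nat, forall m n : nat,
       (N <= m)%N -> (N <= n)%N -> cnorm (u m - u n) < e) ->
    exists l : A, forall e : R, 0 < e -> exists N : nat, forall n : nat,
       (N <= n)%N -> cnorm (u n - l) < e
}.

#[short(type="cstarAlgType")]
HB.structure Definition CStarAlgebra (R : realType) :=
  { A of isCStar R A & GRing.Algebra R[i] A }.

Definition lspan (R : realType) (A : lmodType R[i]) (S : set A) : set A :=
  [set a | exists (n : nat) (c : 'I_n -> R[i]) (v : 'I_n -> A),
     (forall i, S (v i)) /\ a = \sum_i c i *: v i].

Definition norm_dense (R : realType) (A : cstarAlgType R) (S : set A) : Prop :=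
  forall (a : A) (e : R), 0 < e -> exists2 s, S s & cnorm (a - s) < e.

Definition is_state (R : realType) (A : cstarAlgType R) (phi : {scalar A}) :
    Prop :=
  phi 1 = 1 /\ forall a, 0 <= phi (star a * a).

Definition star_preserving (R : realType) (A B : cstarAlgType R) (f : A -> B) :
    Prop :=
  forall a, f (star a) = star (f a).

Definition is_product_state (R : realType) (A B T : cstarAlgType R)
    (t : A -> B -> T) (phi : {scalar A}) (psi : {scalar B}) (th : {scalar T}) :
    Prop :=
  is_state th /\ forall a b, th (t a b) = phi a * psi b.

(* [T], with [t a b] in the role of a (x) b, is the minimal (spatial) tensor
   product of [A] and [B].  The last two fields say that the product states
   extend to [T] and that the norm of [T] is the operator norm in the direct sum
   of the GNS representations of all product states; as the GNS representation
   of phi (x) psi is the tensor product of those of phi and psi, this is the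
   spatial norm computed in the universal representations of [A] and [B]. *)
Record is_min_tensor (R : realType) (A B T : cstarAlgType R)
    (t : A -> B -> T) : Prop := {
  mint_linearl : forall b, linear (t^~ b) ;
  mint_linearr : forall a, linear (t a) ;
  mint_mul : forall a a' b b', t a b * t a' b' = t (a * a') (b * b') ;
  mint_one : t 1 1 = 1 ;
  mint_star : forall a b, star (t a b) = t (star a) (star b) ;
  mint_dense : norm_dense (lspan [set z | exists a b, z = t a b]) ;
  mint_state : forall (phi : {scalar A}) (psi : {scalar B}),
    is_state phi -> is_state psi ->
    exists th : {scalar T}, is_product_state t phi psi th ;
  mint_norm : forall (z : T) (M : R), 0 <= M ->
    cnorm z <= M <->
    (forall (phi : {scalar A}) (psi : {scalar B}) (th : {scalar T}),
       is_state phi -> is_state psi -> is_product_state t phi psi th ->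
       forall y : T, complex.Re (th (star (z * y) * (z * y)))
                     <= M ^+ 2 * complex.Re (th (star y * y)))
}.

(* Woronowicz's compact quantum groups: the *-homomorphisms [cqg_Dl] and
   [cqg_Dr] are Delta (x) id and id (x) Delta, determined by their values on
   elementary tensors. *)
Record cqg (R : realType) : Type := {
  cqg_alg :> cstarAlgType R ;
  cqg_alg2 : cstarAlgType R ;
  cqg_alg3 : cstarAlgType R ;
  tens2 : cqg_alg -> cqg_alg -> cqg_alg2 ;
  tens21 : cqg_alg2 -> cqg_alg -> cqg_alg3 ;
  tens12 : cqg_alg -> cqg_alg2 -> cqg_alg3 ;
  tens2_min : is_min_tensor tens2 ;
  tens21_min : is_min_tensor tens21 ;
  tens12_min : is_min_tensor tens12 ;
  tens_assoc : forall a b c, tens21 (tens2 a b) c = tens12 a (tens2 b c) ;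
  Delta : {lrmorphism cqg_alg -> cqg_alg2} ;
  cqg_Dl : {lrmorphism cqg_alg2 -> cqg_alg3} ;
  cqg_Dr : {lrmorphism cqg_alg2 -> cqg_alg3} ;
  Delta_star : star_preserving Delta ;
  cqg_Dl_star : star_preserving cqg_Dl ;
  cqg_Dr_star : star_preserving cqg_Dr ;
  cqg_DlE : forall a b, cqg_Dl (tens2 a b) = tens21 (Delta a) b ;
  cqg_DrE : forall a b, cqg_Dr (tens2 a b) = tens12 a (Delta b) ;
  Delta_coassoc : forall a, cqg_Dl (Delta a) = cqg_Dr (Delta a) ;
  Delta_cancell :
    norm_dense (lspan [set z | exists a b, z = Delta a * tens2 b 1]) ;
  Delta_cancelr :
    norm_dense (lspan [set z | exists a b, z = Delta a * tens2 1 b])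
}.

Definition norm_bounded (R : realType) (A B : cstarAlgType R) (f : A -> B) :
    Prop :=
  exists M : R, forall a, cnorm (f a) <= M * cnorm a.

(* [Sl] and [Sr] are the slice maps h (x) id and id (x) h. *)
Definition is_haar (R : realType) (G : cqg R) (h : {scalar G}) : Prop :=
  [/\ is_state h,
      exists Sl : {linear cqg_alg2 G -> G},
        [/\ norm_bounded Sl, forall a b, Sl (tens2 a b) = h a *: b
          & forall a, Sl (Delta G a) = (h a)%:A]
    & exists Sr : {linear cqg_alg2 G -> G},
        [/\ norm_bounded Sr, forall a b, Sr (tens2 a b) = h b *: a
          & forall a, Sr (Delta G a) = (h a)%:A] ].

(* The adjoint of a matrix over [A], and the matrix T (x) 1 over [A]. *)
Definition mxstar (R : realType) (A : cstarAlgType R) m n (u : 'M[A]_(m, n)) :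
    'M[A]_(n, m) :=
  (map_mx star u)^T.

Definition mxC (R : realType) (A : cstarAlgType R) m n (T : 'M[R[i]]_(m, n)) :
    'M[A]_(m, n) :=
  map_mx (fun c : R[i] => c%:A) T.
Arguments mxC {R} A {m n} T.

Definition is_urep (R : realType) (G : cqg R) n (u : 'M[G]_n) : Prop :=
  [/\ (0 < n)%N, mxstar u *m u = 1%:M, u *m mxstar u = 1%:M
    & forall i j, Delta G (u i j) = \sum_k tens2 (u i k) (u k j)].

Record urep (R : realType) (G : cqg R) : Type := Urep {
  urep_dim : nat ;
  urep_mx :> 'M[G]_urep_dim ;
  urepP : is_urep urep_mx
}.

HB.instance Definition _ (R : realType) (G : cqg R) :=
  gen_eqMixin (urep G).
HB.instance Definition _ (R : realType) (G : cqg R) :=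
  gen_choiceMixin (urep G).

Definition uequiv (R : realType) (G : cqg R) (u v : urep G) : Prop :=
  exists T : 'M[R[i]]_(urep_dim v, urep_dim u),
    [/\ T^t* *m T = 1%:M, T *m T^t* = 1%:M
      & mxC G T *m u = v *m mxC G T].

Section Lemmas.
Context (R : realType).
Implicit Types (A : cstarAlgType R) (G : cqg R).

Lemma mxC_mul A m n p (S : 'M[R[i]]_(m, n)) (T : 'M[R[i]]_(n, p)) :
  mxC A (S *m T) = mxC A S *m mxC A T.
Proof.
apply/matrixP => i j; rewrite !mxE scaler_suml; apply: eq_bigr => k _.
by rewrite !mxE -scalerAl mul1r scalerA.
Qed.

Lemma mxC1 A n : mxC A (1%:M : 'M[R[i]]_n) = 1%:M.
Proof.
by apply/matrixP => i j; rewrite !mxE; case: eqP; rewrite ?scale1r ?scale0r.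
Qed.

Lemma uequiv_refl G (u : urep G) : uequiv u u.
Proof.
exists 1%:M; have -> : (1%:M : 'M[R[i]]_(urep_dim u))^t* = 1%:M.
  by rewrite trmx1 map_mx1.
by rewrite mxC1 !mul1mx mulmx1.
Qed.

Lemma uequiv_sym G (u v : urep G) : uequiv u v -> uequiv v u.
Proof.
move=> [T [T1 T2 Tuv]]; exists (T^t*); split; rewrite ?trmxCK //.
rewrite -[LHS]mulmx1 -mxC1 -T2 mxC_mul !mulmxA -(mulmxA _ v) -Tuv.
by rewrite mulmxA -mxC_mul T1 mxC1 mul1mx.
Qed.

Lemma uequiv_trans G (u v w : urep G) :
  uequiv u v -> uequiv v w -> uequiv u w.
Proof.
move=> [S [S1 S2 Suv]] [T [T1 T2 Tvw]]; exists (T *m S).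
have e : (T *m S)^t* = S^t* *m T^t* by rewrite trmx_mul map_mxM.
split; rewrite ?e.
- by rewrite mulmxA -(mulmxA _ (T^t*)) T1 mulmx1 S1.
- by rewrite mulmxA -(mulmxA T) S2 mulmx1 T2.
- by rewrite mxC_mul -mulmxA Suv mulmxA Tvw mulmxA.
Qed.

Lemma star0 A : star (0 : A) = 0.
Proof.
have /eqP := starD (0 : A) 0.
by rewrite addr0 -subr_eq0 opprD addrA subrr sub0r oppr_eq0 => /eqP.
Qed.

Lemma star1 A : star (1 : A) = 1.
Proof. by rewrite -[LHS]mulr1 -[X in _ * X]starK -starM mulr1 starK. Qed.

Lemma star_sum A I (r : seq I) (F : I -> A) :
  star (\sum_(i <- r) F i) = \sum_(i <- r) star (F i).
Proof. by elim/big_rec2: _ => [|i x y _ <-]; rewrite ?star0 ?starD. Qed.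

Lemma map_mxdiag (V W : nmodType) (f : V -> W) n (d : 'I_n -> nat)
    (u : forall i, 'M[V]_(d i)) :
  f 0 = 0 -> map_mx f (\mxdiag_i u i) = \mxdiag_i map_mx f (u i).
Proof.
move=> f0; apply/matrixP => i j; rewrite !mxE.
case: eqVneq => [e|_]; last by rewrite !mxE.
move: (tagnat.sig2 i) (tagnat.sig2 j).
by rewrite -e => a b; rewrite !conform_mx_id !mxE.
Qed.

Lemma mul_mxdiag (A : pzSemiRingType) n (d : 'I_n -> nat)
    (u v : forall i, 'M[A]_(d i)) :
  (\mxdiag_i u i) *m (\mxdiag_i v i) = \mxdiag_i (u i *m v i).
Proof.
rewrite {2 3}/mxdiag mul_mxdiag_mxblock; apply/eq_mxblock => i j.
by case: eqVneq => [<-|_]; rewrite ?conform_mx_id ?mulmx0.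
Qed.

Lemma tens2l0 G b : tens2 (0 : G) b = 0.
Proof.
have /(_ (-1) 0 0) := mint_linearl (tens2_min G) b.
by rewrite scaleN1r oppr0 add0r scaleN1r addNr.
Qed.

Lemma tens2r0 G a : tens2 a (0 : G) = 0.
Proof.
have /(_ (-1) 0 0) := mint_linearr (tens2_min G) a.
by rewrite scaleN1r oppr0 add0r scaleN1r addNr.
Qed.

Lemma mx_DeltaP G n (u : 'M[G]_n) :
  (forall i j, Delta G (u i j) = \sum_k tens2 (u i k) (u k j)) <->
  map_mx (Delta G) u = map_mx (fun a => tens2 a 1) u *m map_mx (tens2 1) u.
Proof.
have e i k j : tens2 (u i k) (u k j) = tens2 (u i k) 1 * tens2 1 (u k j).
  by rewrite (mint_mul (tens2_min G)) mulr1 mul1r.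
split=> [H|/matrixP H].
  by apply/matrixP => i j; rewrite !mxE H; apply: eq_bigr => k _; rewrite e !mxE.
move=> i j; have := H i j; rewrite !mxE => ->.
by apply: eq_bigr => k _; rewrite e !mxE.
Qed.

Lemma mxdiag_is_urep G n (u : 'I_n.+1 -> urep G) :
  is_urep (\mxdiag_i (u i : 'M[G]_(urep_dim (u i)))).
Proof.
have es : mxstar (\mxdiag_i (u i : 'M[G]_(urep_dim (u i)))) =
    \mxdiag_i mxstar (u i).
  by rewrite /mxstar map_mxdiag ?star0// tr_mxdiag.
split.
- by rewrite (bigD1 ord0)//= addn_gt0; case: (urepP (u ord0)) => ->.
- rewrite es mul_mxdiag -(mxdiagZ 1); apply: eq_mxdiag => i.
  by case: (urepP (u i)).
- rewrite es mul_mxdiag -(mxdiagZ 1); apply: eq_mxdiag => i.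
  by case: (urepP (u i)).
- apply/mx_DeltaP; rewrite !map_mxdiag ?linear0 ?tens2l0 ?tens2r0// mul_mxdiag.
  by apply: eq_mxdiag => i; apply/mx_DeltaP; case: (urepP (u i)).
Qed.

Lemma sum_tens (V : nmodType) m n (F : 'I_(m * n) -> V) :
  \sum_k F k = \sum_i \sum_j F (mxtens_index (i, j)).
Proof.
rewrite pair_big (reindex (@mxtens_index m n)) /=; first by apply: eq_bigr => -[].
by exists (@mxtens_unindex m n) => k _; rewrite ?mxtens_indexK ?mxtens_unindexK.
Qed.

Lemma mxstar_mull A n (u : 'M[A]_n) : mxstar u *m u = 1%:M <->
  forall i j, \sum_k star (u k i) * u k j = (i == j)%:R.
Proof.
split=> [/matrixP H i j|H].
  by have := H i j; rewrite !mxE => <-; apply: eq_bigr => k _; rewrite !mxE.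
by apply/matrixP => i j; rewrite !mxE -H; apply: eq_bigr => k _; rewrite !mxE.
Qed.

Lemma mxstar_mulr A n (u : 'M[A]_n) : u *m mxstar u = 1%:M <->
  forall i j, \sum_k u i k * star (u j k) = (i == j)%:R.
Proof.
split=> [/matrixP H i j|H].
  by have := H i j; rewrite !mxE => <-; apply: eq_bigr => k _; rewrite !mxE.
by apply/matrixP => i j; rewrite !mxE -H; apply: eq_bigr => k _; rewrite !mxE.
Qed.

Lemma tensmx_is_urep G (u v : urep G) : is_urep (tensmx u v).
Proof.
case: (urepP u) (urepP v) => u0 /mxstar_mull u1 /mxstar_mulr u2 uD.
case=> v0 /mxstar_mull v1 /mxstar_mulr v2 vD.
split; first by rewrite muln_gt0 u0.
- apply/mxstar_mull => i j.
  case: (mxtens_indexP i) => i1 i2; case: (mxtens_indexP j) => j1 j2.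
  rewrite (can_eq (@mxtens_indexK _ _)) xpair_eqE -mulnb natrM -(u1 i1) -(v1 i2).
  rewrite sum_tens exchange_big mulr_sumr; apply: eq_bigr => l _ /=.
  transitivity (star (v l i2) * (\sum_k star (u k i1) * u k j1) * v l j2).
    rewrite mulr_sumr mulr_suml; apply: eq_bigr => k _.
    by rewrite !tensmxE starM !mulrA.
  by rewrite u1 -mulrA mulr_natl mulrnAr -mulr_natl.
- apply/mxstar_mulr => i j.
  case: (mxtens_indexP i) => i1 i2; case: (mxtens_indexP j) => j1 j2.
  rewrite (can_eq (@mxtens_indexK _ _)) xpair_eqE -mulnb natrM -(u2 i1) -(v2 i2).
  rewrite sum_tens mulr_suml; apply: eq_bigr => k _ /=.
  transitivity (u i1 k * (\sum_l v i2 l * star (v j2 l)) * star (u j1 k)).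
    rewrite mulr_sumr mulr_suml; apply: eq_bigr => l _.
    by rewrite !tensmxE starM !mulrA.
  by rewrite v2 -mulrA mulr_natl mulrnAr -mulr_natr.
- move=> i j.
  case: (mxtens_indexP i) => i1 i2; case: (mxtens_indexP j) => j1 j2.
  have DM (a b : G) : Delta G (a * b) = Delta G a * Delta G b by exact: rmorphM.
  rewrite tensmxE DM uD vD sum_tens mulr_suml.
  apply: eq_bigr => k _; rewrite mulr_sumr; apply: eq_bigr => l _.
  by rewrite (mint_mul (tens2_min G)) !tensmxE.
Qed.

End Lemmas.

Definition uequivb (R : realType) (G : cqg R) (u v : urep G) : bool :=
  `[< uequiv u v >].

Lemma uequivb_equiv (R : realType) (G : cqg R) :
  equiv_class_of (@uequivb R G).
Proof.
split=> [u|u v|v u w].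
- exact/asboolP/uequiv_refl.
- by apply/asboolP/asboolP; exact: uequiv_sym.
- by move=> /asboolP uv /asboolP vw; apply/asboolP/(uequiv_trans uv vw).
Qed.

Canonical uequiv_rel (R : realType) (G : cqg R) :=
  EquivRelPack (@uequivb_equiv R G).

(* Rep(G): the set of unitary equivalence classes *)
Definition Rep (R : realType) (G : cqg R) := {eq_quot (uequiv_rel G)}.
HB.instance Definition _ (R : realType) (G : cqg R) :=
  Choice.on (Rep G).

Section Rep.
Context (R : realType) (G : cqg R).
Implicit Types (p q : Rep G) (u v : urep G).

Definition rep_class u : Rep G := \pi_(Rep G) u.

Definition rep_tens p q : Rep G :=
  rep_class (Urep (tensmx_is_urep (repr p) (repr q))).

Definition rep_sum n (p : 'I_n.+1 -> Rep G) : Rep G :=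
  rep_class (Urep (mxdiag_is_urep (fun i => repr (p i)))).

Definition rep_dim p : nat := urep_dim (repr p).

Definition chi p : G := \tr (repr p : 'M[G]_(rep_dim p)).

(* No invariant subspace besides 0 and the whole space; a subspace is given by
   its orthogonal projection P, and is invariant when u maps it into itself
   with coefficients in C(G), i.e. u (P (x) 1) = (P (x) 1) u (P (x) 1). *)
Definition irreducible_urep u : Prop :=
  forall P : 'M[R[i]]_(urep_dim u),
    P *m P = P -> P^t* = P ->
    u *m mxC G P = mxC G P *m u *m mxC G P -> P = 0 \/ P = 1%:M.

Definition Irr : set (Rep G) := [set p | irreducible_urep (repr p)].

Definition Pol : set G :=
  lspan [set a | exists p, Irr p /\ exists i j, a = (repr p : urep G) i j].

Section Haar.
Variable h : {scalar G}.

Definition norm2 (a : G) : R := Num.sqrt (complex.Re (h (star a * a))).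

(* The operator norm of left multiplication by x on L^2(G), the Hilbert space
   completion of Pol(G) for the inner product h(a^* b): since Pol(G) is dense,
   the supremum over its unit ball is the operator norm. *)
Definition norm_infty (x : G) : \bar R :=
  ereal_sup [set (norm2 (x * a))%:E | a in [set a | Pol a /\ norm2 a <= 1]].

Definition psdmx n (P : 'M[R[i]]_n) : Prop :=
  forall v : 'rV[R[i]]_n, 0 <= (v *m P *m v^t*) 0 0.

Definition is_Qmx u (Q : 'M[R[i]]_(urep_dim u)) : Prop :=
  [/\ psdmx Q, Q \in unitmx, \tr Q = \tr (invmx Q)
    & forall i j l m,
        h (star (u i j) * u l m) = (j == m)%:R * invmx Q l i / \tr Q].

Definition Qmx p : 'M[R[i]]_(rep_dim p) := xget 0 [set Q | is_Qmx Q].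

(* |M| = (M^* M)^(1/2) *)
Definition absmx n (M : 'M[R[i]]_n) : 'M[R[i]]_n :=
  xget 0 [set P | psdmx P /\ P *m P = M^t* *m M].

Definition fourier (x : G) p : 'M[R[i]]_(rep_dim p) :=
  \matrix_(i, j) h (mxstar (repr p : urep G) i j * x).

Definition fourier_norm1 (x : G) : \bar R :=
  \esum_(p in Irr)
    (complex.Re (\tr (Qmx p) * \tr (absmx (fourier x p *m Qmx p))))%:E.

Definition central_sidon (E : set (Rep G)) : Prop :=
  E `<=` Irr /\
  exists2 K : R, 0 < K &
    forall c : Rep G -> R[i], finite_set [set p | E p /\ c p != 0] ->
      (fourier_norm1 (\sum_(p \in E) c p *: chi p)%R
         <= K%:E * norm_infty (\sum_(p \in E) c p *: chi p)%R)%E.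
End Haar.
End Rep.

(* Main.v *)
(* The map chi_p |-> chi_(Phi p) is a *-isomorphism from the character algebra of
   G1 onto a subalgebra of that of G2: products are preserved by the fusion rules,
   adjoints because the conjugate of p is the irreducible q such that the trivial
   representation occurs in q (x) p.  It preserves the Haar states, which count the
   multiplicity of the trivial representation, hence the L^2-norms.  The norm of x
   in L^infty is therefore determined by characters once it is known to be attained
   on a subspace of characters invariant under x and x^*.  For b in Pol(G), the
   functional z |-> h(b^* z b) sees only finitely many characters, so the moments
   h(b^* (x^* x)^n b) grow no faster than the norm of (x^* x)^n on such a subspace,
   which bounds |x b|_2.  The Fourier norm of a combination of characters is the sum
   of dim(p) |c_p|, so the Sidon inequality transfers with constant C K.

   The orthogonality relations, complete reducibility and the existence of unitary
   conjugates all rest on one consequence of the cancellation property: the linear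
   equations satisfied by the matrices h(b u), b in C(G), are also satisfied by
   their adjoints. *)
Require Import Defs.
From mathcomp Require Import all_boot all_order all_algebra generic_quotient.
From mathcomp Require Import sesquilinear spectral complex mxtens finmap ring lra.
From mathcomp Require Import all_classical all_reals all_analysis.

Set Implicit Arguments.
Unset Strict Implicit.
Unset Printing Implicit Defensive.

Import Order.TTheory GRing.Theory Num.Theory.
Local Open Scope classical_set_scope.
Local Open Scope ring_scope.
Local Open Scope quotient_scope.
Local Open Scope sesquilinear_scope.

(** * C-star algebras and states *)

(** Two obstacles shape the proof. The Haar state may fail to be faithful on C(G), so coefficients
    are only handled modulo null elements, those a with h(b a) = 0 for all b. Unitarity and the
    adjoint principle [annih_adj], which does the work of an antipode, ensure that no nonzero row
    combination x u is lost in this way ([row_null]). Moreover [h] need not be a trace, so a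
    state-preserving projection of L^infty onto the characters is not at hand, and the norm cannot
    be read off the characters by compression. Moments are therefore taken at each vector b; the
    price is a constant depending on b, which disappears under 2^k-th roots. *)

Lemma Re_normr_ge0 (R : realType) (z : R[i]) : 0 <= complex.Re `|z|.
Proof. by have := normr_ge0 z; rewrite lecE /= => /andP[]. Qed.

(** The arithmetic end of polarization: [p] and [q] are the two mixed terms of a sesquilinear form,
    tested on a + b and on a + i b. It serves states ([state_herm]) and matrices ([psdmx_herm])
    alike. *)
Lemma conj_polar (R : realType) (p q : R[i]) :
  (p + q)^* = p + q -> ('i * p - 'i * q)^* = 'i * p - 'i * q -> q = p^*.
Proof.
rewrite rmorphD /= rmorphB !rmorphM /= conjCi => h1 h2.
have {}h2 : q^* - p^* = p - q.
  by apply: (mulfI (neq0Ci R[i])); rewrite [RHS]mulrBr -h2; ring.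
have : 2 * (q^* - p) = (p^* + q^* - (p + q)) + (q^* - p^* - (p - q)) by ring.
rewrite h1 h2 !subrr addr0 => /eqP.
by rewrite mulf_eq0 pnatr_eq0/= subr_eq0 => /eqP <-; rewrite conjCK.
Qed.

Section CStarTheory.
Context (R : realType) (A : cstarAlgType R).
Implicit Types a b x y : A.

Lemma cnorm0 : cnorm (0 : A) = 0.
Proof. by rewrite -(scale0r (0 : A)) cnormZ normr0 mul0r. Qed.

Lemma cnormN a : cnorm (- a) = cnorm a.
Proof. by rewrite -scaleN1r cnormZ normrN1 /= mul1r. Qed.

Lemma cnorm_ge0 a : 0 <= cnorm a.
Proof. by have := ler_cnormD a (- a); rewrite subrr cnorm0 cnormN; lra. Qed.

Lemma starN a : star (- a) = - star a.
Proof. by apply/eqP; rewrite -addr_eq0 -starD addNr star0. Qed.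

Lemma starB a b : star (a - b) = star a - star b.
Proof. by rewrite starD starN. Qed.

Lemma ler_cnormB a b : cnorm (a - b) <= cnorm a + cnorm b.
Proof. by rewrite -[in leRHS](cnormN b) ler_cnormD. Qed.

Lemma cnorm_star a : cnorm (star a) = cnorm a.
Proof.
suff le b : cnorm b <= cnorm (star b).
  by apply/eqP; rewrite eq_le le -[X in _ <= cnorm X]starK le.
have [->|b0] := eqVneq (cnorm b) 0; first exact: cnorm_ge0.
have := ler_cnormM (star b) b; rewrite cnorm_starM expr2 ler_pM2r//.
by rewrite lt_neqAle eq_sym b0 cnorm_ge0.
Qed.

Lemma cnormZ_real (t : R) a : 0 <= t -> cnorm (t%:C%C *: a) = t * cnorm a.
Proof. by move=> t0; rewrite cnormZ ger0_norm// lecR. Qed.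

Lemma conjc_realC (t : R) : (t%:C%C : R[i])^* = t%:C%C.
Proof. exact: conjc_real. Qed.

(* The root is 1 - y, where y is the limit of the iterates of
   y |-> (x + y^2) / 2, a contraction of the ball of radius 1/2. *)
Lemma cstar_sqrt1B x : star x = x -> cnorm x <= 3 / 4 ->
  exists s, star s = s /\ s * s = 1 - x.
Proof.
move=> sx nx; pose half := (1 / 2 : R)%:C%C.
have halfC : half^* = half by exact: conjc_realC.
have hh : half + half = 1.
  rewrite /half; apply/eqP; rewrite eq_complex /= addr0 eqxx andbT; apply/eqP; lra.
pose T y := half *: (x + y * y).
have nT y z : cnorm y <= 1/2 -> cnorm z <= 1/2 ->
    cnorm (T y - T z) <= 1/2 * cnorm (y - z).
  move=> ny nz; rewrite /T -scalerBr cnormZ_real; last by lra.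
  rewrite ler_pM2l; last by lra.
  have -> : x + y * y - (x + z * z) = y * (y - z) + (y - z) * z.
    rewrite mulrBr mulrBl addrA subrK opprD addrACA subrr add0r //.
  apply: le_trans (ler_cnormD _ _) _.
  have := ler_cnormM y (y - z); have := ler_cnormM (y - z) z.
  by have := cnorm_ge0 (y - z); nra.
(* The bound 3/4 on [x] comes from here: (3/4 + 1/4) / 2 = 1/2. *)
have T12 y : cnorm y <= 1/2 -> cnorm (T y) <= 1/2.
  move=> ny; rewrite /T cnormZ_real; last by lra.
  have := ler_cnormD x (y * y); have := ler_cnormM y y.
  by have := cnorm_ge0 y; nra.
pose u n := iter n T 0.
have u12 n : cnorm (u n) <= 1/2.
  by elim: n => [|n IH]; [rewrite cnorm0; lra | exact: T12].
have uS n k : cnorm (u (n + k)%N - u n) <= (1/2) ^+ n.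
  elim: n => [|n IH]; first by rewrite add0n subr0 expr0 (le_trans (u12 _))//; lra.
  rewrite addSn /= exprS (le_trans (nT _ _ (u12 _) (u12 _)))//.
  by rewrite ler_pM2l; [exact: IH | lra].
have [l ul] : exists l : A, forall e : R, 0 < e -> exists N : nat, forall n : nat,
       (N <= n)%N -> cnorm (u n - l) < e.
  apply: cnorm_complete => e e0.
  have : exists N, (1/2 : R) ^+ N < e / 2.
    have h1 : `|1 / 2 : R| < 1 by rewrite ger0_norm; lra.
    have [|N _ /(_ N (leqnn N))] := (@cvgrPdist_lt _ _ _ _ _ _ _).1 (cvg_expr h1) (e / 2); first by lra.
    by rewrite sub0r normrN ger0_norm ?exprn_ge0//; exists N.
  case=> N HN; exists N => m n Nm Nn.
  have -> : u m - u n = (u m - u N) - (u n - u N) by rewrite opprB addrA subrK.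
  apply: le_lt_trans (ler_cnormB _ _) _.
  have := uS N (m - N)%N; have := uS N (n - N)%N.
  by rewrite !subnKC//; lra.
have nl : cnorm l <= 1/2.
  apply/ler_addgt0Pr => e /ul [N /(_ N (leqnn N))].
  by have := ler_cnormB (u N) (u N - l); rewrite subKr; have := u12 N; lra.
have lT : T l = l.
  apply/eqP; rewrite -subr_eq0; apply/eqP/cnorm0_eq0/eqP.
  rewrite eq_le cnorm_ge0 andbT; apply/ler_addgt0Pr => e e0.
  have e2 : 0 < e / 2 by lra.
  have [N HN] := ul _ e2.
  have := HN N.+1 (leqnSn N); have := HN N (leqnn N).
  have := nT _ _ nl (u12 N).
  have -> : T l - l = (T l - T (u N)) + (u N.+1 - l) by rewrite addrA subrK.
  have := ler_cnormD (T l - T (u N)) (u N.+1 - l).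
  by rewrite -(cnormN (l - u N)) opprB; lra.
have sl : star l = l.
  apply/eqP; rewrite -subr_eq0; apply/eqP/cnorm0_eq0/eqP.
  rewrite eq_le cnorm_ge0 andbT; apply/ler_addgt0Pr => e e0.
  have su n : star (u n) = u n.
    elim: n => [|n IH]; first by rewrite star0.
    by rewrite /= /T starZ starD starM sx -/(u n) IH halfC.
  have e2 : 0 < e / 2 by lra.
  have [N /(_ N (leqnn N)) HN] := ul _ e2.
  have -> : star l - l = (u N - l) - star (u N - l).
    by rewrite starB su opprB [RHS]addrC addrA subrK.
  apply: le_trans (ler_cnormB _ _) _; rewrite cnorm_star; lra.
exists (1 - l); split; first by rewrite starB star1 sl.
rewrite mulrBr mulr1 mulrBl mul1r.
have l2 : l + l = x + l * l.
  by rewrite -[in LHS]lT /T -scalerDl hh scale1r.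
have -> : x = l + l - l * l by rewrite l2 addrK.
by rewrite -addrA -opprD addrA.
Qed.

Variable phi : {scalar A}.
Hypothesis phi_state : is_state phi.

Let phi_ge0 a : 0 <= phi (star a * a) := phi_state.2 a.

Lemma stateZ (c : R[i]) a : phi (c *: a) = c * phi a.
Proof. by rewrite linearZ. Qed.

Lemma state_sesqui (k l : R[i]) a b :
  phi (star (k *: a) * (l *: b)) = k^* * l * phi (star a * b).
Proof. by rewrite starZ -scalerAl -scalerAr !stateZ mulrA. Qed.

Lemma state_polar a b :
  phi (star (a + b) * (a + b)) =
  phi (star a * a) + phi (star b * b) + (phi (star a * b) + phi (star b * a)).
Proof.
rewrite starD mulrDr !mulrDl !linearD /=; ring.
Qed.

Lemma state_herm a b : phi (star b * a) = (phi (star a * b))^*.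
Proof.
have r0 (z : R[i]) : 0 <= z -> z^* = z by move=> /ger0_real /CrealP.
have h1 : (phi (star a * b) + phi (star b * a))^* =
    phi (star a * b) + phi (star b * a).
  have /r0 := phi_ge0 (a + b); rewrite state_polar rmorphD /= => H.
  rewrite rmorphD /= !(r0 _ (phi_ge0 _)) in H.
  by move/addrI: H.
have h2 : ('i * phi (star a * b) - 'i * phi (star b * a))^* =
    'i * phi (star a * b) - 'i * phi (star b * a).
  have /r0 := phi_ge0 (a + 'i *: b); rewrite state_polar rmorphD /= => H.
  rewrite rmorphD /= !(r0 _ (phi_ge0 _)) in H.
  move/addrI: H.
  by rewrite starZ -scalerAr -scalerAl !stateZ conjCi mulNr.
exact: conj_polar.
Qed.

Lemma state_CS a b :
  `|phi (star a * b)| ^+ 2 <= phi (star a * a) * phi (star b * b).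
Proof.
set p := phi (star a * b); set al := phi (star a * a); set be := phi (star b * b).
have al0 : 0 <= al := phi_ge0 a.
have be0 : 0 <= be := phi_ge0 b.
have H (c : R[i]) : 0 <= al + (c * c^*) * be + (c * p + (c * p)^*).
  have := phi_ge0 (a + c *: b); rewrite state_polar (state_herm a (c *: b)).
  have -> : phi (star a * (c *: b)) = c * p by rewrite -scalerAr stateZ.
  suff -> : phi (star (c *: b) * (c *: b)) = c * c^* * be by [].
  by rewrite state_sesqui mulrC [c^* * _]mulrC mulrC.
have [be_eq0|be_neq0] := eqVneq be 0.
  have [->|p0] := eqVneq p 0; first by rewrite normr0 expr0n /= mulr_ge0.
  have := H (- (al + 1) / p); rewrite mulfVK//.
  have -> : (- (al + 1))^* = - (al + 1).
    by apply: conj_Creal; rewrite rpredN rpredD ?rpred1 ?ger0_real.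
  rewrite be_eq0 mulr0 addr0.
  have -> : al + (- (al + 1) + - (al + 1)) = - (al + 2) by ring.
  by rewrite oppr_ge0 lt_geF ?ltr_wpDl ?ltr0n.
have be_gt0 : 0 < be by rewrite lt_neqAle eq_sym be_neq0 be0.
have bec : be^* = be by apply: conj_Creal; exact: ger0_real.
have cc : (- p^* / be)^* = - p / be by rewrite rmorphM fmorphV rmorphN /= conjCK bec.
have c2 : (- p^* / be * p)^* = - p / be * p^* by rewrite rmorphM /= cc.
have := H (- p^* / be); rewrite c2 cc -(pmulr_rge0 _ be_gt0).
rewrite normCK -[in X in _ -> X]subr_ge0; congr (0 <= _); field.
by rewrite be_neq0.
Qed.

Lemma ge0_Re (z : R[i]) : 0 <= z -> z = (complex.Re z)%:C%C.
Proof. by case: z => x y; rewrite lecE /= => /andP[/eqP -> _]. Qed.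

(** Since 1 - t a^* a has a self-adjoint root for t = 3 / (4 |a|^2), positivity gives phi(a^* a) <=
    (4/3) |a|^2, and Cauchy-Schwarz against 1 passes to phi(a). The factor 2 is crude; the lemma
    serves as continuity of states. *)
Lemma state_bounded a : `|phi a| <= (2 * cnorm a)%:C%C.
Proof.
have [/cnorm0_eq0 -> |a0] := eqVneq (cnorm a) 0.
  by rewrite linear0 normr0 cnorm0 mulr0.
have agt0 : 0 < cnorm a by rewrite lt_neqAle eq_sym a0 cnorm_ge0.
pose t := 3 / (4 * cnorm a ^+ 2).
have t0 : 0 < t by rewrite divr_gt0 ?mulr_gt0 ?exprn_gt0.
have [||s [ss sE]] := @cstar_sqrt1B (t%:C%C *: (star a * a)).
- by rewrite starZ conjc_realC starM starK.
- rewrite cnormZ_real ?(ltW t0)// cnorm_starM /t.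
  by rewrite le_eqVlt; apply/orP; left; apply/eqP; field.
have := phi_ge0 s; rewrite ss sE raddfB /= stateZ (phi_state.1).
have := state_CS 1 a; rewrite star1 !mul1r phi_state.1 mul1r => CS.
rewrite subr_ge0 => H.
rewrite -(@ler_pXn2r _ 2)// ?nnegrE// ?lecR ?mulr_ge0 ?cnorm_ge0//.
apply: (le_trans CS).
have tC : 0 < t%:C%C :> R[i] by rewrite ltcR.
rewrite -(ler_pM2l tC) (le_trans H)// -rmorphXn -rmorphM /= -[1]/(1%:C%C) lecR.
rewrite /t exprMn.
have -> : 3 / (4 * cnorm a ^+ 2) * (2 ^+ 2 * cnorm a ^+ 2) = 3 :> R by field.
by lra.
Qed.
End CStarTheory.

(** * Slices of the Haar state *)
Section Tensor.
Context (R : realType) (G : cqg R).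
Implicit Types a b c d : G.

Lemma tens2Zl (k : R[i]) a b : tens2 (k *: a) b = k *: tens2 a b.
Proof.
by have := mint_linearl (tens2_min G) b k a 0; rewrite /= tens2l0 !addr0.
Qed.

Lemma tens2Dl a a' b : tens2 (a + a') b = tens2 a b + tens2 a' b.
Proof.
by have := mint_linearl (tens2_min G) b 1 a a'; rewrite /= !scale1r.
Qed.

Lemma tens2Dr a b b' : tens2 a (b + b') = tens2 a b + tens2 a b'.
Proof.
by have := mint_linearr (tens2_min G) a 1 b b'; rewrite /= !scale1r.
Qed.

Lemma tens2_suml I (r : seq I) (F : I -> G) b :
  tens2 (\sum_(i <- r) F i) b = \sum_(i <- r) tens2 (F i) b.
Proof.
elim/big_rec2: _ => [|i x y _ <-]; [exact: tens2l0 | exact: tens2Dl].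
Qed.

Lemma tens2_sumr I (r : seq I) (F : I -> G) a :
  tens2 a (\sum_(i <- r) F i) = \sum_(i <- r) tens2 a (F i).
Proof.
elim/big_rec2: _ => [|i x y _ <-]; [exact: tens2r0 | exact: tens2Dr].
Qed.

Lemma tens2M a b c d : tens2 a b * tens2 c d = tens2 (a * c) (b * d).
Proof. exact: mint_mul (tens2_min G) a c b d. Qed.

Lemma DeltaM a b : Delta G (a * b) = Delta G a * Delta G b.
Proof. exact: rmorphM. Qed.

Lemma dense_le0 (A : cstarAlgType R) (S : set A) (z : A) (v M : R) :
  norm_dense S -> (forall s, S s -> v <= M * cnorm (z - s)) -> v <= 0.
Proof.
move=> dS H; apply/ler_addgt0Pr => e e0; rewrite add0r.
have M0 : 0 < `|M| + 1 by rewrite ltr_wpDl.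
have [s Ss zs] := dS z (e / (`|M| + 1)) (divr_gt0 e0 M0).
apply: le_trans (H s Ss) _; apply: le_trans (_ : (`|M| + 1) * cnorm (z - s) <= _).
  by rewrite ler_wpM2r ?cnorm_ge0// (le_trans (ler_norm _))// lerDl.
by rewrite mulrC -ler_pdivlMr// ltW.
Qed.

Lemma lspan_ind (A : lmodType R[i]) (S : set A) (P : A -> Prop) :
  P 0 -> (forall (k : R[i]) v w, S v -> P w -> P (k *: v + w)) ->
  forall v, lspan S v -> P v.
Proof.
move=> P0 PS _ [n [c [v [Sv ->]]]].
by elim/big_rec: _ => // i w _; exact: PS.
Qed.

Lemma bounded_linear_ext (B : cstarAlgType R) (f : cqg_alg2 G -> B) :
  linear f -> norm_bounded f -> (forall a b, f (tens2 a b) = 0) ->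
  forall z, f z = 0.
Proof.
move=> fl [M fM] f0 z; apply/cnorm0_eq0/eqP; rewrite eq_le cnorm_ge0 andbT.
apply: (dense_le0 (M := M) (z := z) (mint_dense (tens2_min G))) => s Ss.
apply: le_trans (fM _).
suff fs : f s = 0 by rewrite addrC -scaleN1r fl fs scaler0 add0r.
elim/lspan_ind: Ss => [|c v w [a [b ->]] fw]; last by rewrite fl f0 fw scaler0 addr0.
by have := fl (-1) 0 0; rewrite !scaleN1r oppr0 add0r addNr.
Qed.

(** Both sides are bounded in [z], so elementary tensors decide. This makes a slice map linear over
    the leg that it leaves alone. *)
Lemma slice_mulr (S : {linear cqg_alg2 G -> G}) (e : cqg_alg2 G) (d : G) :
  norm_bounded S -> (forall a b, S (tens2 a b * e) = S (tens2 a b) * d) ->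
  forall z, S (z * e) = S z * d.
Proof.
move=> [M SM] Se z.
have M0 : 0 <= M.
  have := le_trans (cnorm_ge0 (S 1)) (SM 1); rewrite pmulr_lge0//.
  rewrite lt_neqAle cnorm_ge0 andbT eq_sym; apply/eqP => /cnorm0_eq0 /eqP.
  by rewrite oner_eq0.
apply/eqP; rewrite -subr_eq0; apply/eqP; move: z.
apply: bounded_linear_ext => [k a b||a b]; last by rewrite Se subrr.
  by rewrite mulrDl -scalerAl !linearP /= mulrDl -scalerAl scalerBr opprD addrACA.
exists (M * cnorm e + M * cnorm d) => a.
apply: le_trans (ler_cnormB _ _) _; rewrite mulrDl lerD//.
  by apply: le_trans (SM _) _; rewrite -mulrA ler_wpM2l// mulrC ler_cnormM.
by apply: le_trans (ler_cnormM _ _) _; rewrite mulrAC ler_wpM2r ?cnorm_ge0.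
Qed.

(** Unitarity is left out so that entrywise adjoints of unitary representations are included. *)
Definition corep n (u : 'M[G]_n) : Prop :=
  forall i j, Delta G (u i j) = \sum_k tens2 (u i k) (u k j).

End Tensor.

Section Haar.
Context (R : realType) (G : cqg R) (h : {scalar G}) (haar : is_haar h).
Implicit Types a b c d : G.

Let h_state : is_state h. Proof. by case: haar. Qed.

Lemma haar_left : exists Sl : {linear cqg_alg2 G -> G},
  [/\ norm_bounded Sl, forall a b, Sl (tens2 a b) = h a *: b,
      forall a, Sl (Delta G a) = (h a)%:A
    & forall z d, Sl (z * tens2 1 d) = Sl z * d].
Proof.
have [_ [Sl [Sb St SD]] _] := haar; exists Sl; split=> // z d.
by apply: slice_mulr => // a b; rewrite tens2M mulr1 !St scalerAl.
Qed.

Lemma haar_right : exists Sr : {linear cqg_alg2 G -> G},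
  [/\ norm_bounded Sr, forall a b, Sr (tens2 a b) = h b *: a,
      forall a, Sr (Delta G a) = (h a)%:A
    & forall z d, Sr (z * tens2 d 1) = Sr z * d].
Proof.
have [_ _ [Sr [Sb St SD]]] := haar; exists Sr; split=> // z d.
by apply: slice_mulr => // a b; rewrite tens2M mulr1 !St scalerAl.
Qed.

Lemma haar_Fubini (Sl Sr : {linear cqg_alg2 G -> G}) :
  norm_bounded Sl -> norm_bounded Sr ->
  (forall a b, Sl (tens2 a b) = h a *: b) ->
  (forall a b, Sr (tens2 a b) = h b *: a) ->
  forall z, h (Sl z) = h (Sr z).
Proof.
move=> [M SM] [N SN] Slt Srt z.
(* The difference is placed in [G] as a multiple of 1, to be a bounded map between C*-algebras. *)
pose f z : G := (h (Sl z) - h (Sr z))%:A.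
suff fz : f z = 0.
  apply/eqP; rewrite -subr_eq0; move/eqP: fz.
  by rewrite /f scaler_eq0 oner_eq0 orbF.
apply: bounded_linear_ext => [k a b||a b].
- rewrite /f scalerA -scalerDl; congr (_ *: _).
  by rewrite !(linearP Sl) !(linearP Sr) !(linearP h) /=; ring.
- exists ((2 * M + 2 * N) * cnorm (1 : G)) => a.
  rewrite cnormZ mulrAC ler_wpM2r ?cnorm_ge0// -lecR.
  have -> : (complex.Re `|h (Sl a) - h (Sr a)|)%:C%C = `|h (Sl a) - h (Sr a)|.
    by rewrite -ge0_Re ?normr_ge0.
  apply: le_trans (ler_normB _ _) _.
  apply: le_trans (lerD (state_bounded h_state _) (state_bounded h_state _)) _.
  rewrite -rmorphD /= lecR.
  by have := SM a; have := SN a; lra.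
- by rewrite /f Slt Srt !stateZ mulrC subrr scale0r.
Qed.

(** With [C] read as a linear form on matrices, this is the form applied to [u]; its vanishing under
    h(b .) is one linear equation on the matrix h(b u). *)
Definition mxcoef n (u : 'M[G]_n) (C : 'M[R[i]]_n) : G := \tr (mxC G C *m u).

Lemma mxcoefE n (u : 'M[G]_n) C : mxcoef u C = \sum_i \sum_l C i l *: u l i.
Proof.
apply: eq_bigr => i _; rewrite !mxE; apply: eq_bigr => l _.
by rewrite !mxE -scalerAl mul1r.
Qed.

(* The matrices h(b u), for b in C(G), satisfy the same linear equations as
   their adjoints. *)
Lemma annih_adj n (u : 'M[G]_n) (C : 'M[R[i]]_n) :
  corep u -> u *m mxstar u = 1%:M ->
  (forall b, h (b * mxcoef u C) = 0) -> forall b, h (b * mxcoef u (C^t*)) = 0.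
Proof.
move=> uD uu H b.
have [Sl [Slb Slt SlD SlM]] := haar_left.
have [Sr [Srb Srt SrD SrM]] := haar_right.
have Fub := haar_Fubini Slb Srb Slt Srt.
(* As u u^* = 1, u_il (x) 1 is the sum over j of Delta(u_ij) times 1 (x) u_lj^*, and left invariance
   evaluates the slice of Delta(b' u_ij). *)
have shift b' c i l : Sl (Delta G b' * tens2 (u i l) c) =
    \sum_j h (b' * u i j) *: (star (u l j) * c).
  have -> : tens2 (u i l) c = \sum_j Delta G (u i j) * tens2 1 (star (u l j) * c).
    transitivity (\sum_k tens2 (u i k) ((\sum_j u k j * star (u l j)) * c)).
      rewrite (bigD1 l)//= [X in _ + X]big1 ?addr0 => [|k kl].
        by have /mxstar_mulr-> := uu; rewrite eqxx mul1r.
      by have /mxstar_mulr-> := uu; rewrite (negbTE kl) mul0r tens2r0.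
    under eq_bigr do rewrite mulr_suml tens2_sumr.
    rewrite exchange_big; apply: eq_bigr => j _; rewrite uD mulr_suml.
    by apply: eq_bigr => k _; rewrite tens2M mulr1 mulrA.
  rewrite mulr_sumr linear_sum; apply: eq_bigr => j _ /=.
  by rewrite mulrA -DeltaM SlM SlD -scalerAl mul1r.
(* Conjugation exchanges the two Haar factors: the value for the adjoint of [C] at b', c is the
   conjugate of the value for [C] at c^*, b'^*. The latter, sliced on the other leg, is an instance
   of [H]. *)
have key b' c : h (Sl (Delta G b' * tens2 (mxcoef u (C^t*)) c)) = 0.
  have e C' a1 a2 : h (Sl (Delta G a1 * tens2 (mxcoef u C') a2)) =
      \sum_i \sum_l C' i l * \sum_j h (a1 * u l j) * h (star (u i j) * a2).
    rewrite mxcoefE tens2_suml mulr_sumr !linear_sum /=; apply: eq_bigr => i _.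
    rewrite tens2_suml mulr_sumr !linear_sum /=; apply: eq_bigr => l _.
    rewrite tens2Zl -scalerAr !linearZ /= shift linear_sum; congr (_ * _).
    by apply: eq_bigr => j _; rewrite linearZ.
  have := H (Sr (Delta G (star c) * tens2 1 (star b'))).
  rewrite -SrM -mulrA tens2M mulr1 mul1r -Fub !e exchange_big /=.
  move/(congr1 (fun z : R[i] => z^*)); rewrite rmorph0 rmorph_sum /= => e0; rewrite -[RHS]e0.
  apply: eq_bigr => l _; rewrite rmorph_sum; apply: eq_bigr => i _ /=.
  rewrite rmorphM !mxE rmorph_sum; congr (_ * _); apply: eq_bigr => j _ /=.
  by rewrite rmorphM /= mulrC -!(state_herm h_state) starK.
pose g := mxcoef u (C^t*).
suff : complex.Re `|h (b * g)| <= 0.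
  rewrite -lecR -ge0_Re ?normr_ge0// normr_le0 => /eqP //.
have [M SM] := Slb.
(* Cancellation: b (x) 1 is a limit of sums of Delta(a) times 1 (x) c, and on these [key] gives
   zero. *)
apply: (@dense_le0 R _ _ (tens2 b 1) _ (2 * (`|M| * cnorm (tens2 g 1))) (@Delta_cancelr R G)).
move=> s Ss.
have s0 : h (Sl (s * tens2 g 1)) = 0.
  elim/lspan_ind: Ss => [|k v w [a [c ->]] IH]; first by rewrite mul0r !linear0.
  rewrite mulrDl -scalerAl !linearP /= IH addr0 -mulrA tens2M mul1r mulr1.
  by rewrite key mulr0.
have -> : h (b * g) = h (Sl ((tens2 b 1 - s) * tens2 g 1)).
  by rewrite mulrBl !linearB /= s0 subr0 tens2M mulr1 Slt linearZ /= (h_state.1) mulr1.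
rewrite -lecR -ge0_Re ?normr_ge0//.
apply: le_trans (state_bounded h_state _) _; rewrite lecR -!mulrA ler_pM2l//.
apply: le_trans (SM _) _.
apply: (@le_trans _ _ (`|M| * cnorm ((tens2 b 1 - s) * tens2 g 1))).
  by rewrite ler_wpM2r ?cnorm_ge0 ?ler_norm.
by rewrite ler_wpM2l// mulrC ler_cnormM.
Qed.

End Haar.

(** * Matrices over the complex numbers and over the algebra *)

Section MatrixOverC.
Context (R : realType).
Local Notation C := R[i].

Lemma adjmxM m n p (A : 'M[C]_(m, n)) (B : 'M[C]_(n, p)) :
  (A *m B)^t* = B^t* *m A^t*.
Proof. by rewrite trmx_mul map_mxM. Qed.

Lemma adjmx1 n : (1%:M : 'M[C]_n)^t* = 1%:M.
Proof. by rewrite trmx1 map_mx1. Qed.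

Lemma adjmx0 m n : (0 : 'M[C]_(m, n))^t* = 0.
Proof. by rewrite trmx0 map_mx0. Qed.

Lemma adjmxB m n (A B : 'M[C]_(m, n)) : (A - B)^t* = A^t* - B^t*.
Proof. by rewrite raddfB /= map_mxB. Qed.

Lemma adjmxZ m n k (A : 'M[C]_(m, n)) : (k *: A)^t* = k^* *: A^t*.
Proof. by apply/matrixP => i j; rewrite !mxE rmorphM. Qed.

Lemma mxtrace_adj_eq0 m n (A : 'M[C]_(m, n)) : \tr (A^t* *m A) = 0 -> A = 0.
Proof.
have pos i j : 0 <= (A^t* i j) * A j i by rewrite !mxE mulrC mul_conjC_ge0.
move=> /eqP; rewrite /mxtrace psumr_eq0 => [/allP H|i _]; last first.
  by rewrite mxE sumr_ge0.
apply/matrixP => i j; have /= := H j (mem_index_enum _).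
rewrite mxE psumr_eq0// => /allP/(_ i (mem_index_enum _)).
by rewrite /= !mxE mulrC mul_conjC_eq0 => /eqP.
Qed.

Lemma adjmx_mul_eq0 m n (A : 'M[C]_(m, n)) : A^t* *m A = 0 -> A = 0.
Proof. by move=> e; apply: mxtrace_adj_eq0; rewrite e mxtrace0. Qed.

Lemma mulmx1_sq m n (A : 'M[C]_(m, n)) (B : 'M[C]_(n, m)) :
  m = n -> A *m B = 1%:M -> B *m A = 1%:M.
Proof. by move=> mn; subst n; exact: mulmx1C. Qed.

(** Gram-Schmidt on a row basis of [M]: [W^t* *m W] is the orthogonal projection onto its row space.
    The factor [K] lets relations satisfied by [M] pass to [W]. *)
Lemma orthonormal_rows m n (M : 'M[C]_(m, n)) :
  exists r (W : 'M[C]_(r, n)) (K : 'M[C]_(r, m)),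
    [/\ W *m W^t* = 1%:M, M *m (W^t* *m W) = M & W = K *m M].
Proof.
have W1 := schmidt_unitarymx (row_base M) (rank_leq_col M).
have eW := eqmx_schmidt_free (row_base_free M).
move: (schmidt _) W1 eW => W W1 eW; exists (\rank M), W.
have /submxP [K WK] : (W <= M)%MS by rewrite eW eq_row_base.
have /submxP [L ML] : (M <= W)%MS by rewrite eW eq_row_base.
move: W1 => /unitarymxP W1; exists K; split=> //.
transitivity (L *m W *m (W^t* *m W)); first by rewrite -ML.
by rewrite mulmxA -(mulmxA L) W1 mulmx1 -ML.
Qed.

Lemma proj_isometry n (P : 'M[C]_n) : P *m P = P -> P^t* = P ->
  exists r (V : 'M[C]_(n, r)), V^t* *m V = 1%:M /\ V *m V^t* = P.
Proof.
move=> PP Pa; have [r [W [K [W1 PW WK]]]] := orthonormal_rows P.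
exists r, (W^t*); rewrite trmxCK; split=> //.
have WP : W *m P = W by rewrite WK -mulmxA PP.
have : (P *m (W^t* *m W))^t* = P by rewrite PW.
by rewrite !adjmxM trmxCK Pa -mulmxA WP.
Qed.

End MatrixOverC.

Section MatrixOverA.
Context (R : realType) (A : cstarAlgType R).

Lemma mxstarM m n p (u : 'M[A]_(m, n)) (v : 'M[A]_(n, p)) :
  mxstar (u *m v) = mxstar v *m mxstar u.
Proof.
apply/matrixP => i j; rewrite !mxE star_sum; apply: eq_bigr => k _.
by rewrite !mxE starM.
Qed.

Lemma mxstarK m n (u : 'M[A]_(m, n)) : mxstar (mxstar u) = u.
Proof. by apply/matrixP => i j; rewrite !mxE starK. Qed.

Lemma mxstarC m n (T : 'M[R[i]]_(m, n)) : mxstar (mxC A T) = mxC A (T^t*).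
Proof. by apply/matrixP => i j; rewrite !mxE starZ star1. Qed.

Lemma mxC0 m n : mxC A (0 : 'M[R[i]]_(m, n)) = 0.
Proof. by apply/matrixP => i j; rewrite !mxE scale0r. Qed.

Lemma mxCB m n (S T : 'M[R[i]]_(m, n)) : mxC A (S - T) = mxC A S - mxC A T.
Proof. by apply/matrixP => i j; rewrite !mxE scalerBl. Qed.

Lemma mxC_mulE m n p (S : 'M[R[i]]_(m, n)) (u : 'M[A]_(n, p)) i j :
  (mxC A S *m u) i j = \sum_k S i k *: u k j.
Proof.
by rewrite !mxE; apply: eq_bigr => k _; rewrite !mxE -scalerAl mul1r.
Qed.

Lemma mul_mxCE m n p (u : 'M[A]_(m, n)) (S : 'M[R[i]]_(n, p)) i j :
  (u *m mxC A S) i j = \sum_k S k j *: u i k.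
Proof.
by rewrite !mxE; apply: eq_bigr => k _; rewrite !mxE -scalerAr mulr1.
Qed.

(** Cyclicity of the trace fails for noncommuting entries, but scalar factors can still be moved
    around. *)
Lemma mxtrace_conj m n (S : 'M[R[i]]_(m, n)) (T : 'M[R[i]]_(n, m)) (u : 'M[A]_n) :
  T *m S = 1%:M -> \tr (mxC A S *m u *m mxC A T) = \tr u.
Proof.
move=> TS; rewrite -[u in RHS]mul1mx -mxC1 -TS mxC_mul -[in RHS]mulmxA.
move: (_ *m u) => w; rewrite /mxtrace; under eq_bigr do rewrite mul_mxCE.
under [RHS]eq_bigr do rewrite mxC_mulE.
rewrite exchange_big; apply: eq_bigr => i _; apply: eq_bigr => k _ /=.
by [].
Qed.

End MatrixOverA.

(** * Consequences of the invariance of the Haar state *)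

Section Invariance.
Context (R : realType) (G : cqg R) (h : {scalar G}) (haar : is_haar h).
Implicit Types a b c d : G.

Let h_state : is_state h. Proof. by case: haar. Qed.

Lemma corep_bar n (u : 'M[G]_n) : corep u -> corep (map_mx star u).
Proof.
move=> uD i j; rewrite mxE (@Delta_star R G) uD star_sum; apply: eq_bigr => k _.
by rewrite !mxE (mint_star (tens2_min G)).
Qed.

(** Left invariance of [h] on v_ij w_kl, with j and l read as matrix indices. When [v] is the
    entrywise adjoint of a unitary u, it says that [Y] intertwines [w] and u. *)
Lemma inv_left n m (v : 'M[G]_n) (w : 'M[G]_m) i k : corep v -> corep w ->
  let Y := \matrix_(j, l) h (v i j * w k l) in
  v^T *m mxC G Y *m w = mxC G Y.
Proof.
move=> vD wD Y; have [Sl [_ Slt SlD _]] := haar_left haar.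
apply/matrixP => j l; rewrite !mxE -SlD DeltaM vD wD mulr_suml linear_sum /=.
under [RHS]eq_bigr do rewrite mulr_sumr linear_sum /=.
rewrite exchange_big /=; apply: eq_bigr => b _.
rewrite mul_mxCE mulr_suml; apply: eq_bigr => a _.
by rewrite tens2M Slt !mxE scalerAl.
Qed.

Lemma inv_right n m (v : 'M[G]_n) (w : 'M[G]_m) j l : corep v -> corep w ->
  let X := \matrix_(i, k) h (v i j * w k l) in
  v *m mxC G X *m w^T = mxC G X.
Proof.
move=> vD wD X; have [Sr [_ Srt SrD _]] := haar_right haar.
apply/matrixP => i k; rewrite !mxE -SrD DeltaM vD wD mulr_suml linear_sum /=.
under [RHS]eq_bigr do rewrite mulr_sumr linear_sum /=.
rewrite exchange_big /=; apply: eq_bigr => b _.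
rewrite mul_mxCE mulr_suml; apply: eq_bigr => a _.
by rewrite tens2M Srt !mxE scalerAl.
Qed.

(** Entry (i, j) of A u B is the linear form with matrix B E_ji A; the adjoint of that matrix gives
    entry (j, i) of B^* u A^*, so [annih_adj] applies entrywise. *)
Lemma annih_mx n p q (u : 'M[G]_n) (A : 'M[R[i]]_(p, n)) (B : 'M[R[i]]_(n, q)) :
  corep u -> u *m mxstar u = 1%:M ->
  (forall b i j, h (b * (mxC G A *m u *m mxC G B) i j) = 0) ->
  forall b i j, h (b * (mxC G (B^t*) *m u *m mxC G (A^t*)) i j) = 0.
Proof.
move=> uD uu H b j i.
have e p' q' (A' : 'M[R[i]]_(p', n)) (B' : 'M[R[i]]_(n, q')) i' j' :
    (mxC G A' *m u *m mxC G B') i' j' = mxcoef u (B' *m delta_mx j' i' *m A').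
  rewrite mul_mxCE mxcoefE; apply: eq_bigr => k _; rewrite mxC_mulE scaler_sumr.
  apply: eq_bigr => l _; rewrite scalerA; congr (_ *: _).
  rewrite -(mul_delta_mx (0 : 'I_1)) mulmxA -colE -mulmxA -rowE mxE big_ord1.
  by rewrite !mxE.
rewrite e.
have -> : A^t* *m delta_mx i j *m B^t* = (B *m delta_mx j i *m A)^t*.
  rewrite !adjmxM mulmxA; congr (_ *m _ *m _).
  by apply/matrixP => x y; rewrite !mxE andbC rmorph_nat.
by apply: annih_adj => // b'; rewrite -e.
Qed.

End Invariance.

(** * Intertwiners and Schur orthogonality *)
Section ScaleMx.
Context (R : realType) (A : cstarAlgType R).

Lemma mxCZl m n p (k : R[i]) (S : 'M[R[i]]_(m, n)) (u : 'M[A]_(n, p)) :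
  mxC A (k *: S) *m u = map_mx ( *:%R k) (mxC A S *m u).
Proof.
apply/matrixP => i j; rewrite mxC_mulE [RHS]mxE mxC_mulE scaler_sumr.
by apply: eq_bigr => l _; rewrite mxE scalerA.
Qed.

Lemma mxCZr m n p (k : R[i]) (u : 'M[A]_(m, n)) (S : 'M[R[i]]_(n, p)) :
  u *m mxC A (k *: S) = map_mx ( *:%R k) (u *m mxC A S).
Proof.
apply/matrixP => i j; rewrite mul_mxCE [RHS]mxE mul_mxCE scaler_sumr.
by apply: eq_bigr => l _; rewrite mxE scalerA.
Qed.

End ScaleMx.

Section Averages.
Context (R : realType) (G : cqg R) (h : {scalar G}) (haar : is_haar h).

Let h_state : is_state h. Proof. by case: haar. Qed.

Lemma haar_mxCr m n p (u : 'M[G]_(m, n)) (S : 'M[R[i]]_(n, p)) :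
  map_mx h (u *m mxC G S) = map_mx h u *m S.
Proof.
apply/matrixP => i j; rewrite mxE mul_mxCE linear_sum mxE.
by apply: eq_bigr => k _; rewrite stateZ mxE mulrC.
Qed.

Lemma haar_mxC m n (S : 'M[R[i]]_(m, n)) : map_mx h (mxC G S) = S.
Proof. by apply/matrixP => i j; rewrite !mxE stateZ h_state.1 mulr1. Qed.

Lemma state_null (a : G) : h (star a * a) = 0 -> forall b, h (b * a) = 0.
Proof.
move=> a0 b; have := state_CS h_state (star b) a.
by rewrite starK a0 mulr0 -normrX normr_le0 sqrf_eq0 => /eqP.
Qed.

(** Linear in [X]; [inv_left] is the case of a matrix unit. *)
Lemma average_left n m (v : 'M[G]_n) (w : 'M[G]_m) (X : 'M[R[i]]_(n, m)) :
  corep v -> corep w ->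
  let Y := map_mx h (v^T *m mxC G X *m w) in v^T *m mxC G Y *m w = mxC G Y.
Proof.
move=> vD wD Y; apply/matrixP => j l.
pose Z i k := \matrix_(a, b) h (v i a * w k b) : 'M[R[i]]_(n, m).
have YE a b : Y a b = \sum_k \sum_i X i k * Z i k a b.
  rewrite mxE !mxE linear_sum; apply: eq_bigr => k _ /=.
  rewrite mul_mxCE mulr_suml linear_sum; apply: eq_bigr => i _ /=.
  by rewrite !mxE -scalerAl stateZ.
transitivity (\sum_k \sum_i X i k *: (v^T *m mxC G (Z i k) *m w) j l).
  rewrite mxE.
  transitivity (\sum_b \sum_a Y a b *: (v a j * w b l)).
    apply: eq_bigr => b _; rewrite mul_mxCE mulr_suml; apply: eq_bigr => a _.
    by rewrite -scalerAl [v^T _ _]mxE.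
  under eq_bigr => b _ do under eq_bigr => a _ do
    (rewrite YE scaler_suml; under eq_bigr => k _ do rewrite scaler_suml).
  under eq_bigr => b _ do rewrite exchange_big /=.
  rewrite exchange_big /=; apply: eq_bigr => k _.
  under eq_bigr => b _ do rewrite exchange_big /=.
  rewrite exchange_big /=; apply: eq_bigr => i _.
  rewrite mxE scaler_sumr; apply: eq_bigr => b _.
  rewrite mul_mxCE mulr_suml scaler_sumr; apply: eq_bigr => a _.
  by rewrite -scalerAl scalerA [v^T _ _]mxE.
rewrite [RHS]mxE YE scaler_suml; apply: eq_bigr => k _.
rewrite scaler_suml; apply: eq_bigr => i _.
by rewrite (inv_left haar i k vD wD) mxE scalerA.
Qed.

End Averages.

Section Reps.
Context (R : realType) (G : cqg R) (h : {scalar G}) (haar : is_haar h).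
Implicit Types (u v w : urep G).

Let h_state : is_state h. Proof. by case: haar. Qed.

Lemma urep_coisometry u : (u : 'M[G]_(urep_dim u)) *m mxstar u = 1%:M.
Proof. by case: (urepP u). Qed.

Lemma urep_isometry u : mxstar u *m (u : 'M[G]_(urep_dim u)) = 1%:M.
Proof. by case: (urepP u). Qed.

Lemma urep_corep u : corep (u : 'M[G]_(urep_dim u)).
Proof. by case: (urepP u). Qed.
Arguments urep_corep : clear implicits.

Lemma urep_dim_gt0 u : (0 < urep_dim u)%N.
Proof. by case: (urepP u). Qed.

(* The Haar average T of u^* P u commutes with u.  Invariance of P gives T P = P,
   and annih_mx turns (1 - P) u P = 0 into h(b (P u (1 - P))_ij) = 0, hence
   T (1 - P) = 0 and T = P. *)
Lemma reducing u (P : 'M[R[i]]_(urep_dim u)) : P *m P = P -> P^t* = P ->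
  u *m mxC G P = mxC G P *m u *m mxC G P -> mxC G P *m u = u *m mxC G P.
Proof.
move=> PP Pa uP.
pose T := map_mx h (mxstar u *m mxC G P *m u).
have Tu : mxC G T *m u = u *m mxC G T.
  have barT : (map_mx star u)^T = mxstar u by [].
  have := average_left haar P (corep_bar (urep_corep u)) (urep_corep u).
  rewrite barT -/T => /(congr1 (mulmx (u : 'M[G]_(urep_dim u)))).
  by rewrite !mulmxA urep_coisometry mul1mx.
suff -> : P = T by exact: Tu.
have TP : T *m P = P.
  rewrite -haar_mxCr -[RHS](haar_mxC haar); congr map_mx.
  rewrite -!mulmxA uP !mulmxA -(mulmxA _ (mxC G P) (mxC G P)) -mxC_mul PP.
  by rewrite -!mulmxA (mulmxA (mxC G P)) -uP mulmxA urep_isometry mul1mx.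
suff TQ : T *m (1%:M - P) = 0.
  by move: TQ; rewrite mulmxBr mulmx1 TP => /eqP; rewrite subr_eq0 => /eqP ->.
have H b i j : h (b * (mxC G P *m u *m mxC G (1%:M - P)) i j) = 0.
  have Pa' : P = P^t* by rewrite Pa.
  have Qa : 1%:M - P = (1%:M - P)^t* by rewrite adjmxB adjmx1 Pa.
  rewrite Qa [X in mxC G X]Pa'; apply: (annih_mx haar (urep_corep u) (urep_coisometry u)).
  move=> b' i' j'; rewrite mxCB mxC1 !mulmxBl mul1mx -uP subrr.
  by rewrite mxE mulr0 linear0.
rewrite -haar_mxCr -!mulmxA; apply/matrixP => i j; rewrite !mxE linear_sum big1// => k _.
by rewrite /= mulmxA; exact: H.
Qed.

(** If x u is null, so is u x^* by [annih_mx], and x x^* is the Haar average of x u^* times u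
    x^*. *)
Lemma row_null u (x : 'rV[R[i]]_(urep_dim u)) :
  (forall b l, h (b * (mxC G x *m u) 0 l) = 0) -> x = 0.
Proof.
move=> H.
have H' b i : h (b * (u *m mxC G (x^t*)) i 0) = 0.
  have := annih_mx haar (A := x) (B := 1%:M) (urep_corep u) (urep_coisometry u).
  rewrite adjmx1 mxC1 !mul1mx mulmx1; apply => b' i' j; rewrite ord1; exact: H.
suff : x *m x^t* = 0.
  by rewrite -{1}[x]trmxCK => /adjmx_mul_eq0 x0; rewrite -[x]trmxCK x0 adjmx0.
rewrite -(haar_mxC haar (x *m x^t*)) mxC_mul -[X in X *m _]mulmx1.
rewrite -(urep_isometry u) -[mxC G x]mxstarK mxstarC.
rewrite mulmxA -mxstarM -mulmxA; apply/matrixP => i j; rewrite ord1 (ord1 j) !mxE.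
by rewrite linear_sum big1// => k _; rewrite mxE; exact: H'.
Qed.

(** The orthogonal projection 1 - Q onto the kernel of [Y] is invariant under [u], because Q is a
    left multiple of [Y]; irreducibility leaves only 0 and 1. *)
Lemma intertwiner_inj u n (v : 'M[G]_n) (Y : 'M[R[i]]_(n, urep_dim u)) :
  irreducible_urep u -> mxC G Y *m u = v *m mxC G Y ->
  Y = 0 \/ exists L, L *m Y = 1%:M.
Proof.
move=> uI Yu; have [r [W [K [W1 YW WK]]]] := orthonormal_rows Y.
pose Q := W^t* *m W.
have QQ : Q *m Q = Q by rewrite /Q mulmxA -(mulmxA _ W) W1 mulmx1.
have Qa : Q^t* = Q by rewrite /Q adjmxM trmxCK.
have [|||e|e] := uI (1%:M - Q).
- by rewrite mulmxBr mulmx1 mulmxBl mul1mx QQ subrr subr0.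
- by rewrite adjmxB adjmx1 Qa.
- have QE : Q = W^t* *m K *m Y by rewrite -mulmxA -WK.
  set P := 1%:M - Q.
  have YP : Y *m P = 0 by rewrite mulmxBr mulmx1 YW subrr.
  have : mxC G Q *m u *m mxC G P = 0.
    by rewrite QE mxC_mul -(mulmxA (mxC G _)) Yu -!mulmxA -mxC_mul YP mxC0 !mulmx0.
  by rewrite {3}/P mxCB mxC1 !mulmxBl !mul1mx => ->; rewrite subr0.
- right; exists (W^t* *m K); rewrite -mulmxA -WK -/Q.
  by apply/eqP; rewrite eq_sym -subr_eq0 e.
- left; rewrite -YW -/Q.
  have -> : Q = 0 by rewrite -[Q]opprK -[- Q](addKr 1%:M) e addNr oppr0.
  by rewrite mulmx0.
Qed.

Lemma intertwiner_scalar u (S : 'M[R[i]]_(urep_dim u)) :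
  irreducible_urep u -> mxC G S *m u = u *m mxC G S -> exists k, S = k%:M.
Proof.
move=> uI Su; have [k /eigenvalueP [x xS x0]] := eigenvalue_closed S (urep_dim_gt0 u).
exists k; apply/eqP; rewrite -subr_eq0; apply/eqP.
have [||[L LS]] // := @intertwiner_inj u _ u (S - k%:M) uI.
  rewrite mxCB mulmxBl mulmxBr Su; congr (_ - _).
  by rewrite -scalemx1 mxCZl mxCZr mxC1 mul1mx mulmx1.
move: x0; rewrite -[x]mulmx1 -(mulmx1C LS) mulmxA mulmxBr xS mul_mx_scalar subrr.
by rewrite mul0mx eqxx.
Qed.

Lemma intertwiner_adj u v (Y : 'M[R[i]]_(urep_dim u, urep_dim v)) :
  mxC G Y *m v = u *m mxC G Y -> mxC G (Y^t*) *m u = v *m mxC G (Y^t*).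
Proof.
move=> /(congr1 (@mxstar _ _ _ _)); rewrite !mxstarM !mxstarC => e.
rewrite -[LHS]mul1mx -(urep_coisometry v) -mulmxA (mulmxA _ _ u) e.
by rewrite -!mulmxA urep_isometry mulmx1.
Qed.

(** For a nonzero [Y], Y^* Y is an intertwiner, hence a scalar k > 0, and Y / sqrt k is the unitary
    equivalence. It is square because [Y] and its adjoint are both injective. *)
Lemma schur u v (Y : 'M[R[i]]_(urep_dim u, urep_dim v)) :
  irreducible_urep u -> irreducible_urep v ->
  mxC G Y *m v = u *m mxC G Y -> Y = 0 \/ uequiv v u.
Proof.
move=> uI vI Yv; have [->|[L LY]] := intertwiner_inj vI Yv; first by left.
have Yu := intertwiner_adj Yv.
have [e|[L' LY']] := intertwiner_inj uI Yu.
  by left; rewrite -[Y]trmxCK e adjmx0.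
right.
have duv : urep_dim u = urep_dim v.
  apply/eqP; rewrite eqn_leq.
  by rewrite (mulmx1_min LY) (mulmx1_min LY').
have [|k kE] := intertwiner_scalar (S := Y^t* *m Y) vI.
  by rewrite mxC_mul -mulmxA Yv mulmxA Yu mulmxA.
have v0 := urep_dim_gt0 v; pose i0 := Ordinal v0.
have kge : 0 <= k.
  have /matrixP/(_ i0 i0) := kE; rewrite !mxE eqxx mulr1n => <-.
  by apply: sumr_ge0 => j _; rewrite !mxE mulrC mul_conjC_ge0.
have k0 : k != 0.
  apply/eqP => k0; move: kE; rewrite k0 => kE.
  have Y0 : Y = 0.
    by apply: adjmx_mul_eq0; rewrite kE; apply/matrixP => i j; rewrite !mxE mul0rn.
  move: LY; rewrite Y0 mulmx0 => /matrixP/(_ i0 i0); rewrite !mxE eqxx => /eqP.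
  by rewrite eq_sym oner_eq0.
pose s := (sqrtC k)^-1.
have sc : s^* = s by rewrite conj_Creal// ger0_real// invr_ge0 sqrtC_ge0.
have T1 : (s *: Y)^t* *m (s *: Y) = 1%:M.
  rewrite adjmxZ sc -scalemxAl -scalemxAr scalerA kE scale_scalar_mx.
  by rewrite /s -invfM -expr2 sqrtCK mulVf.
exists (s *: Y); split=> //; first exact: mulmx1_sq T1.
by rewrite mxCZl mxCZr Yv.
Qed.

End Reps.
Arguments urep_corep {R G} u.

(** * Positive matrices and the orthogonality relations *)

Section PosDef.
Context (R : realType).
Local Notation C := R[i].

(** [psdmx] only constrains the quadratic form; over the complex numbers polarization recovers
    symmetry. *)
Lemma psdmx_herm n (P : 'M[C]_n) : psdmx P -> P^t* = P.
Proof.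
move=> P0; pose f (v w : 'rV[C]_n) := (v *m P *m w^t*) 0 0.
have fr v : (f v v)^* = f v v by apply/CrealP/ger0_real/P0.
have fD v w : f (v + w) (v + w) = f v v + f w w + (f v w + f w v).
  by rewrite /f raddfD /= map_mxD !mulmxDl !mulmxDr !mxE; ring.
have fZl k v w : f (k *: v) w = k * f v w.
  by rewrite /f -!scalemxAl mxE.
have fZr k v w : f v (k *: w) = k^* * f v w.
  by rewrite /f adjmxZ -scalemxAr mxE.
have H v w : f w v = (f v w)^*.
  apply: conj_polar.
    by have := fr (v + w); rewrite fD !rmorphD /= !fr => /addrI.
  have := fr (w + 'i *: v).
  rewrite fD !fZl !fZr; set s := f w w + _.
  have sr : s^* = s.
    rewrite /s conjCi mulrA mulrN -expr2 sqrCi opprK mul1r.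
    by rewrite rmorphD /= !fr.
  by rewrite rmorphD /= sr => /addrI; rewrite conjCi mulNr addrC.
have e k l : P k l = f (delta_mx 0 k) (delta_mx 0 l).
  rewrite /f trmx_delta map_delta_mx -rowE -colE.
  by rewrite !mxE.
apply/matrixP => i j; rewrite !mxE e [in RHS]e H conjCK //.
Qed.

Lemma psdmx_factor n (P : 'M[C]_n) : psdmx P -> P \in unitmx ->
  exists2 F : 'M[C]_n, F \in unitmx & P = F *m F^t*.
Proof.
move=> P0 Pu; have Pa := psdmx_herm P0.
have /orthomx_spectralP : P \is normalmx by apply/normalmxP; rewrite Pa.
have U1 := spectral_unitarymx P; set U := spectralmx P in U1 *.
set d := spectral_diag P; rewrite invmx_unitary// => PE.
have d0 i : 0 <= d 0 i.
  have := P0 (row i U); rewrite rowE adjmxM trmx_delta map_delta_mx PE !mulmxA.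
  rewrite -(mulmxA _ U) (unitarymxP U1) mulmx1 -(mulmxA _ U) (unitarymxP U1) mulmx1.
  by rewrite -rowE -colE !mxE eqxx.
have FE : P = (U^t* *m diag_mx (map_mx sqrtC d)) *m (U^t* *m diag_mx (map_mx sqrtC d))^t*.
  rewrite adjmxM trmxCK tr_diag_mx map_diag_mx mulmxA -(mulmxA (U^t*)) mulmx_diag.
  rewrite {1}PE; congr (_ *m diag_mx _ *m _); apply/rowP => j; rewrite !mxE.
  rewrite /= conj_Creal ?ger0_real ?sqrtC_ge0//.
  by rewrite -expr2 sqrtCK.
exists (U^t* *m diag_mx (map_mx sqrtC d)) => //.
by move: Pu; rewrite {1}FE unitmx_mul => /andP[].
Qed.

Lemma psdmx_diag n (P : 'M[C]_n) i : psdmx P -> 0 <= P i i.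
Proof.
move=> /(_ (delta_mx 0 i)); rewrite trmx_delta map_delta_mx -rowE -colE.
by rewrite !mxE.
Qed.

End PosDef.

Section Orthogonality.
Context (R : realType) (G : cqg R) (h : {scalar G}) (haar : is_haar h).
Implicit Types (u v w : urep G).

Let h_state : is_state h. Proof. by case: haar. Qed.

Lemma haar_intertwiner u v i k :
  let Y := \matrix_(j, l) h (star (u i j) * v k l) in
  mxC G Y *m v = u *m mxC G Y.
Proof.
have := inv_left haar i k (corep_bar (urep_corep u)) (urep_corep v).
have -> : \matrix_(j, l) h ((map_mx star u) i j * v k l) =
    \matrix_(j, l) h (star (u i j) * v k l).
  by apply/matrixP => j l; rewrite !mxE.
have -> : (map_mx star u)^T = mxstar u by [].
move=> /= e; rewrite -[in RHS]e !mulmxA urep_coisometry mul1mx //.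
Qed.
Arguments haar_intertwiner : clear implicits.

Lemma haar_orth u v : irreducible_urep u -> irreducible_urep v ->
  ~ uequiv v u -> forall i j k l, h (star (u i j) * v k l) = 0.
Proof.
move=> uI vI uv i j k l.
have [/matrixP/(_ j l)|//] := schur uI vI (haar_intertwiner u v i k).
by rewrite !mxE.
Qed.

Lemma orth_form u (E : 'M[R[i]]_(urep_dim u)) (x : 'rV[R[i]]_(urep_dim u)) j :
  (forall i j l m, h (star (u i j) * u l m) = (j == m)%:R * E l i) ->
  h (star ((mxC G x *m u) 0 j) * (mxC G x *m u) 0 j) = (x *m E *m x^t*) 0 0.
Proof.
move=> EE; rewrite mxC_mulE star_sum mulr_suml linear_sum mxE.
apply: eq_bigr => i _; rewrite mulr_sumr linear_sum /= mxE mulr_suml.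
apply: eq_bigr => l _; rewrite state_sesqui EE eqxx mul1r !mxE; ring.
Qed.

(* The matrix E is Q^-1 / Tr Q in the notation of the orthogonality relations. *)
Lemma haar_orth_left u : irreducible_urep u ->
  exists E : 'M[R[i]]_(urep_dim u),
   [/\ psdmx E, E \in unitmx, \tr E = 1 &
    forall i j l m, h (star (u i j) * u l m) = (j == m)%:R * E l i].
Proof.
move=> uI; pose i0 := Ordinal (urep_dim_gt0 u).
pose E : 'M[R[i]]_(urep_dim u) := \matrix_(l, i) h (star (u i i0) * u l i0).
have EE i j l m : h (star (u i j) * u l m) = (j == m)%:R * E l i.
  have [k /matrixP kE] := intertwiner_scalar uI (haar_intertwiner u u i l).
  have := kE j m; have := kE i0 i0; rewrite !mxE eqxx mulr1n => -> ->.
  by rewrite mulr_natl.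
have E0 x j := orth_form x j EE.
exists E; split=> //.
- by move=> x; rewrite -(E0 x i0); exact: h_state.2.
(* For x in the kernel of [E], [orth_form] makes every entry of x u null, and [row_null] gives x =
   0. *)
- rewrite -row_free_unit -kermx_eq0; apply/rowV0P => x /sub_kermxP xE.
  apply: (row_null haar) => b l; apply: state_null haar _ _ _.
  by rewrite E0 xE mul0mx mxE.
- transitivity (h (\sum_l star (u l i0) * u l i0)).
    by rewrite linear_sum; apply: eq_bigr => l _; rewrite mxE.
  by have /mxstar_mull -> := urep_isometry u; rewrite eqxx h_state.1.
Qed.

Lemma haar_orth_right u : irreducible_urep u ->
  exists E : 'M[R[i]]_(urep_dim u), \tr E = 1 /\
    forall i j k l, h (u i j * star (u k l)) = (i == k)%:R * E l j.
Proof.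
move=> uI; pose i0 := Ordinal (urep_dim_gt0 u).
pose E : 'M[R[i]]_(urep_dim u) := \matrix_(l, j) h (u i0 j * star (u i0 l)).
exists E; split.
  transitivity (h (\sum_l u i0 l * star (u i0 l))).
    by rewrite linear_sum; apply: eq_bigr => l _; rewrite mxE.
  by have /mxstar_mulr -> := urep_coisometry u; rewrite eqxx h_state.1.
move=> i j k l.
pose X : 'M[R[i]]_(urep_dim u) := \matrix_(i, k) h (u i j * star (u k l)).
have Xu : mxC G X *m u = u *m mxC G X.
  have := inv_right haar j l (urep_corep u) (corep_bar (urep_corep u)).
  have -> : \matrix_(i, k) h (u i j * (map_mx star u) k l) = X.
    by apply/matrixP => x y; rewrite !mxE.
  have -> : (map_mx star u)^T = mxstar u by [].
  by move=> /= e; rewrite -[in LHS]e -mulmxA urep_isometry mulmx1.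
have [c /matrixP cE] := intertwiner_scalar uI Xu.
have := cE i k; have := cE i0 i0; rewrite !mxE eqxx mulr1n => -> ->.
by rewrite mulr_natl.
Qed.

Lemma is_Qmx_ex u : irreducible_urep u -> exists Q, is_Qmx h (u := u) Q.
Proof.
move=> uI; have [E [E0 Eu E1 EE]] := haar_orth_left uI.
have Ea := psdmx_herm E0.
have iEa : (invmx E)^t* = invmx E by rewrite trmx_inv map_invmx Ea.
have iE0 : psdmx (invmx E).
  by move=> x; have := E0 (x *m invmx E); rewrite mulmxKV// adjmxM iEa mulmxA.
pose t := \tr (invmx E).
have t0 : 0 < t.
  rewrite lt_neqAle sumr_ge0 ?andbT => [|i _]; last exact: psdmx_diag.
  rewrite eq_sym; apply/eqP => t0.
  have [F Fu FE] : exists2 F, F \in unitmx & invmx E = F *m F^t*.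
    by apply: psdmx_factor; rewrite ?unitmx_inv.
  move: t0; rewrite /t FE -{1}[F]trmxCK => /mxtrace_adj_eq0 F0.
  have : 1%:M = 0 :> 'M[R[i]]_(urep_dim u).
    by rewrite -(mulVmx Fu) -[F in _ *m F]trmxCK F0 adjmx0 mulmx0.
  move=> /matrixP/(_ (Ordinal (urep_dim_gt0 u)) (Ordinal (urep_dim_gt0 u))) /eqP.
  by rewrite !mxE eqxx oner_eq0.
(* For Q = s E^-1, Tr Q = s t while Tr Q^-1 = 1 / s because Tr E = 1; equality forces s =
   t^(-1/2). *)
pose s := (sqrtC t)^-1.
have s0 : 0 < s by rewrite invr_gt0 sqrtC_gt0.
have s2 : s * s = t^-1 by rewrite -expr2 exprVn sqrtCK.
have sn0 : s != 0 by rewrite gt_eqF.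
exists (s *: invmx E).
have iQ : invmx (s *: invmx E) = s^-1 *: E by rewrite invmxZ ?unitmxZ ?unitfE ?unitmx_inv// invmxK.
split.
- by move=> x; rewrite -scalemxAr -scalemxAl mxE mulr_ge0 ?(ltW s0) ?iE0.
- by rewrite unitmxZ ?unitfE// unitmx_inv.
- rewrite iQ !mxtraceZ E1 -/t mulr1; apply: (mulfI sn0).
  by rewrite mulrA s2 mulVf ?gt_eqF// mulfV.
- move=> i j l m; rewrite EE iQ mxE mxtraceZ -/t -mulrA; congr (_ * _).
  by rewrite mulrC mulrA -invfM mulrAC s2 mulVf ?gt_eqF// invr1 mul1r.
Qed.

End Orthogonality.
Arguments haar_intertwiner {R G h} haar u v i k.

(** * Conjugate representations *)
Section Subrep.
Context (R : realType) (G : cqg R).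

Section LinearMap.
Context (A B : cstarAlgType R) (f : A -> B) (fl : linear f).

Let f_sum I (r : seq I) (k : I -> R[i]) (a : I -> A) :
  f (\sum_(i <- r) k i *: a i) = \sum_(i <- r) k i *: f (a i).
Proof.
elim/big_rec2: _ => [|i x y _ <-]; last exact: fl.
by have := fl (-1) 0 0; rewrite !scaleN1r oppr0 add0r addNr.
Qed.

Lemma linear_mxCl m n p (S : 'M[R[i]]_(m, n)) (u : 'M[A]_(n, p)) :
  map_mx f (mxC A S *m u) = mxC B S *m map_mx f u.
Proof.
apply/matrixP => i j; rewrite mxE !mxC_mulE f_sum.
by apply: eq_bigr => k _; rewrite mxE.
Qed.

Lemma linear_mxCr m n p (u : 'M[A]_(m, n)) (S : 'M[R[i]]_(n, p)) :
  map_mx f (u *m mxC A S) = map_mx f u *m mxC B S.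
Proof.
apply/matrixP => i j; rewrite mxE !mul_mxCE f_sum.
by apply: eq_bigr => k _; rewrite mxE.
Qed.

End LinearMap.

(** The idempotent T S can be inserted between the two legs of Delta(S u T), since it commutes with
    [u] and is absorbed by [T]. With T S = 1 this is a change of basis, otherwise the restriction to
    a subspace. *)
Lemma corep_compress m n (u : 'M[G]_n) (S : 'M[R[i]]_(m, n)) (T : 'M[R[i]]_(n, m)) :
  corep u -> mxC G (T *m S) *m u = u *m mxC G (T *m S) -> T *m S *m T = T ->
  corep (mxC G S *m u *m mxC G T).
Proof.
move=> /mx_DeltaP uD TSu TST; apply/mx_DeltaP.
have l1 : linear (fun a : G => tens2 a 1) := mint_linearl (tens2_min G) 1.
have l2 : linear (fun a : G => tens2 1 a) := mint_linearr (tens2_min G) 1.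
have l3 : linear (Delta G) by move=> k a b; rewrite linearP.
have := congr1 (map_mx (fun a : G => tens2 1 a)) TSu.
rewrite !(linear_mxCr l1, linear_mxCl l1, linear_mxCr l2, linear_mxCl l2).
rewrite (linear_mxCr l3) (linear_mxCl l3) uD => e.
rewrite !mulmxA -(mulmxA _ (mxC _ T) (mxC _ S)) -mxC_mul.
rewrite -(mulmxA _ (mxC _ (T *m S))) e !mulmxA -(mulmxA _ (mxC _ (T *m S))) -mxC_mul.
by rewrite TST.
Qed.

End Subrep.

Section Conjugate.
Context (R : realType) (G : cqg R) (h : {scalar G}) (haar : is_haar h).
Implicit Types (u v w : urep G).

Let h_state : is_state h. Proof. by case: haar. Qed.

(* If ub is the entrywise adjoint of u, averaging gives ub E^T ub^* = E^T with
   E^T = N N^*, so v = N^-1 ub N satisfies v v^* = 1.  A left inverse of ub comes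
   from the other average u^T L ub = L; that L is invertible follows from annih_mx
   applied to v. *)
Lemma conj_urep u : irreducible_urep u ->
  exists v, \tr (v : 'M[G]_(urep_dim v)) = star (\tr (u : 'M[G]_(urep_dim u))).
Proof.
move=> uI; have [E [E0 Eu _ EE]] := haar_orth_left haar uI.
have [E' [E'1 E'E]] := haar_orth_right haar uI.
have [F Fu FE] := psdmx_factor E0 Eu.
have uD := urep_corep u.
pose i0 := Ordinal (urep_dim_gt0 u).
pose ub : 'M[G]_(urep_dim u) := map_mx star u.
pose N := map_mx (fun z : R[i] => z^*) F.
have Na : N^t* = F^T by apply/matrixP => i j; rewrite !mxE conjCK.
have NN : N *m N^t* = E^T.
  by rewrite Na FE trmx_mul map_trmx trmxK.
have Nu : N \in unitmx by rewrite map_unitmx.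
have ubE : ub *m mxC G E^T *m mxstar ub = mxC G E^T.
  have := inv_right haar i0 i0 (corep_bar uD) uD; rewrite -/ub.
  have -> : mxstar ub = u^T by apply/matrixP => i j; rewrite !mxE starK.
  suff -> : \matrix_(i, k) h (ub i i0 * u k i0) = E^T by [].
  by apply/matrixP => i k; rewrite !mxE EE eqxx mul1r.
pose v := mxC G (invmx N) *m ub *m mxC G N.
have vD : corep v.
  apply: corep_compress; first exact: corep_bar.
    by rewrite mulmxV// mxC1 mul1mx mulmx1.
  by rewrite mulmxV// mul1mx.
have vv : v *m mxstar v = 1%:M.
  rewrite /v !mxstarM !mxstarC !mulmxA -(mulmxA _ (mxC G N)) -mxC_mul NN.
  rewrite -(mulmxA _ ub) -(mulmxA _ (ub *m _)) ubE -NN -!mxC_mul !mulmxA.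
  by rewrite mulVmx// mul1mx -adjmxM mulVmx// adjmx1 mxC1.
have ubv : ub = mxC G N *m v *m mxC G (invmx N).
  rewrite /v !mulmxA -mxC_mul mulmxV// mxC1 mul1mx -mulmxA -mxC_mul mulmxV//.
  by rewrite mxC1 mulmx1.
pose L := E'^T.
have uL : u^T *m mxC G L *m ub = mxC G L.
  have := inv_left haar i0 i0 uD (corep_bar uD); rewrite -/ub.
  suff -> : \matrix_(j, l) h (u i0 j * ub i0 l) = L by [].
  by apply/matrixP => j l; rewrite !mxE E'E eqxx mul1r.
have Lu : L \in unitmx.
  rewrite -unitmx_tr -row_free_unit -kermx_eq0; apply/rowV0P => x /sub_kermxP xL.
  pose y := x^T.
  have Ly : L *m y = 0 by rewrite -[L]trmxK -trmx_mul xL trmx0.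
  have H1 b i : h (b * (ub *m mxC G y) i 0) = 0.
    apply: (state_null haar); rewrite mul_mxCE star_sum mulr_suml linear_sum.
    transitivity ((y^t* *m (L *m y)) 0 0); last by rewrite Ly mulmx0 mxE.
    rewrite mxE.
    apply: eq_bigr => j _; rewrite mulr_sumr linear_sum [(L *m y) _ _]mxE mulr_sumr.
    apply: eq_bigr => l _ /=; rewrite state_sesqui !mxE starK E'E eqxx mul1r.
    by rewrite mulrA mulrAC.
  pose z := invmx N *m y.
  have H2 b i : h (b * (v *m mxC G z) i 0) = 0.
    have -> : v *m mxC G z = mxC G (invmx N) *m (ub *m mxC G y).
      rewrite /v /z mxC_mul !mulmxA -(mulmxA _ (mxC G N)) -mxC_mul mulmxV//.
      by rewrite mxC1 mulmx1.
    rewrite mxC_mulE mulr_sumr linear_sum big1// => k _.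
    by rewrite -scalerAr stateZ H1 mulr0.
  have H3 b j : h (b * (mxC G (z^t*) *m v) 0 j) = 0.
    have := annih_mx haar (A := 1%:M) (B := z) vD vv.
    rewrite adjmx1 mxC1 !mul1mx mulmx1; apply => b' i' j'; rewrite (ord1 j'); exact: H2.
  pose t := z^t* *m invmx N.
  have H4 b j : h (b * (mxC G t *m ub) 0 j) = 0.
    have -> : mxC G t *m ub = mxC G (z^t*) *m v *m mxC G (invmx N).
      by rewrite ubv /t mxC_mul !mulmxA -(mulmxA _ (mxC G _) (mxC G N))
        -mxC_mul mulVmx// mxC1 mulmx1.
    rewrite mul_mxCE mulr_sumr linear_sum big1// => k _.
    by rewrite -scalerAr stateZ H3 mulr0.
  (* Pairing the l-th entry of t ub with u_kl gives t_k E'_ll, and the trace of E' is 1. *)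
  have t0 : t = 0.
    apply/rowP => k; rewrite [RHS]mxE -[LHS]mulr1 -E'1 mulr_sumr big1// => l _.
    have := H4 (u k l) l; rewrite mxC_mulE mulr_sumr linear_sum /= => <-.
    rewrite (bigD1 k)//= big1 ?addr0 => [|i ik].
      by rewrite -scalerAr stateZ [ub _ _]mxE E'E eqxx mul1r.
    by rewrite -scalerAr stateZ [ub _ _]mxE E'E eq_sym (negbTE ik) mul0r mulr0.
  have z0 : z = 0.
    rewrite -[z]trmxCK -[z^t*]mulmx1 -(mulVmx Nu) mulmxA -/t t0 mul0mx.
    exact: adjmx0.
  have y0 : y = 0 by rewrite -[y](mulKVmx Nu) -/z z0 mulmx0.
  by rewrite -[x]trmxK -/y y0 trmx0.
have vi : mxstar v *m v = 1%:M.
  pose K := mxC G (invmx N) *m (mxC G (invmx L) *m u^T *m mxC G L) *m mxC G N.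
  have Kv : K *m v = 1%:M.
    rewrite /K /v !mulmxA -(mulmxA _ (mxC G N)) -(mxC_mul _ N) mulmxV// mxC1 mulmx1.
    rewrite -!mulmxA (mulmxA _ _ (ub *m _)) (mulmxA _ ub) uL.
    by rewrite !mulmxA -!mxC_mul mulmxKV// mulVmx// mxC1.
  suff -> : mxstar v = K by [].
  by rewrite -[LHS]mul1mx -Kv -mulmxA vv mulmx1.
exists (Urep (And4 (urep_dim_gt0 u) vi vv vD)) => /=.
rewrite /v mxtrace_conj ?mulmxV// /mxtrace star_sum.
by apply: eq_bigr => i _; rewrite mxE.
Qed.

End Conjugate.

(** * Complete reducibility *)
Section RepTheory.
Context (R : realType) (G : cqg R).
Implicit Types (u v w : urep G) (p q : Rep G).

Lemma rep_classP u v : rep_class u = rep_class v <-> uequiv u v.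
Proof.
split=> [/eqmodP|uv]; first by move/asboolP.
by apply/eqmodP/asboolP.
Qed.

Lemma reprK_class p : rep_class (repr p) = p.
Proof. exact: reprK. Qed.

Lemma repr_class u : uequiv (repr (rep_class u)) u.
Proof. by apply/rep_classP; rewrite reprK_class. Qed.

Lemma uequiv_dim u v : uequiv u v -> urep_dim u = urep_dim v.
Proof.
move=> [T [T1 T2 _]]; apply/eqP.
by rewrite eqn_leq (mulmx1_min T1) (mulmx1_min T2).
Qed.

Lemma uequiv_tr u v : uequiv u v ->
  \tr (u : 'M[G]_(urep_dim u)) = \tr (v : 'M[G]_(urep_dim v)).
Proof.
move=> [T [T1 T2 Tuv]]; rewrite -(mxtrace_conj (S := T) (T := T^t*) u T1).
by rewrite Tuv -mulmxA -mxC_mul T2 mxC1 mulmx1.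
Qed.

Lemma chi_class u : chi (rep_class u) = \tr (u : 'M[G]_(urep_dim u)).
Proof. exact/uequiv_tr/repr_class. Qed.

Lemma irreducible_uequiv u v : uequiv u v ->
  irreducible_urep u -> irreducible_urep v.
Proof.
move=> [T [T1 T2 Tuv]] uI P PP Pa vP.
have Tvu : mxC G (T^t*) *m v = u *m mxC G (T^t*).
  rewrite -[LHS]mulmx1 -mxC1 -T2 mxC_mul !mulmxA -(mulmxA _ v) -Tuv.
  by rewrite mulmxA -mxC_mul T1 mxC1 mul1mx.
pose Q := T^t* *m P *m T.
have PE : P = T *m Q *m T^t*.
  by rewrite /Q !mulmxA T2 mul1mx -mulmxA T2 mulmx1.
have [||||] // := uI Q.
- by rewrite /Q !mulmxA -(mulmxA _ T) T2 mulmx1 -(mulmxA _ P P) PP.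
- by rewrite /Q !adjmxM trmxCK Pa mulmxA.
- transitivity (mxC G (T^t*) *m (v *m mxC G P) *m mxC G T).
    by rewrite /Q !mxC_mul !mulmxA Tvu.
  have e : mxC G T *m u *m mxC G (T^t*) = v.
    by rewrite Tuv -mulmxA -mxC_mul T2 mxC1 mulmx1.
  by rewrite vP -[urep_mx v]e /Q !mxC_mul !mulmxA.
- by move=> Q0; left; rewrite PE Q0 mulmx0 mul0mx.
- by move=> Q1; right; rewrite PE Q1 mulmx1 T2.
Qed.

Lemma Irr_class u : irreducible_urep u -> Irr (rep_class u).
Proof. exact/irreducible_uequiv/uequiv_sym/repr_class. Qed.

Lemma chi_tens p q : chi (rep_tens p q) = chi p * chi q.
Proof.
rewrite /rep_tens chi_class /= /mxtrace sum_tens mulr_suml; apply: eq_bigr => i _.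
by rewrite mulr_sumr; apply: eq_bigr => j _; rewrite tensmxE.
Qed.

Lemma chi_sum n (p : 'I_n.+1 -> Rep G) : chi (rep_sum p) = \sum_i chi (p i).
Proof. by rewrite /rep_sum chi_class /= mxtrace_mxdiag. Qed.

Lemma map_mxcol (A B : Type) (f : A -> B) n (d : 'I_n -> nat) m
    (u : forall i, 'M[A]_(d i, m)) :
  map_mx f (\mxcol_i u i) = \mxcol_i map_mx f (u i).
Proof. by apply/matrixP => i j; rewrite !mxE. Qed.

Lemma rep_sum_intro u n (p : 'I_n.+1 -> Rep G)
    (V : forall i, 'M[R[i]]_(urep_dim u, rep_dim (p i))) :
  (forall i, (V i)^t* *m V i = 1%:M) -> \sum_i V i *m (V i)^t* = 1%:M ->
  (forall i, (u : 'M[G]_(urep_dim u)) *m mxC G (V i) = mxC G (V i) *m repr (p i)) ->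
  rep_class u = rep_sum p.
Proof.
move=> V1 V2 Vu; apply/rep_classP.
pose T : 'M[R[i]]_(\sum_i rep_dim (p i), urep_dim u) := \mxcol_i (V i)^t*.
have Ta : T^t* = \mxrow_i V i.
  rewrite /T tr_mxcol; apply/matrixP => i j; rewrite !mxE conjCK //.
have T1 : T^t* *m T = 1%:M by rewrite Ta mul_mxrow_mxcol.
exists T; split=> //.
  (* [T] is an isometry; the traces of the V_i V_i^* show that it is square, hence unitary. *)
  apply: mulmx1_sq T1; apply/eqP; rewrite -(eqr_nat R[i]) /= -mxtrace1 -V2.
  rewrite raddf_sum natr_sum; apply/eqP/eq_bigr => i _ /=.
  by rewrite mxtrace_mulC V1 mxtrace1.
rewrite /= /mxC map_mxcol [RHS]mul_mxdiag_mxcol mxcol_mul; apply: eq_mxcol => i.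
exact: intertwiner_adj (esym (Vu i)).
Qed.

Section Decomposition.
Context (h : {scalar G}) (haar : is_haar h).

(** Restriction to the range of [V]. The dimension is a field of [urep], so it is known only up to
    the equality [e], along which [V] is cast. *)
Lemma subrep u r (V : 'M[R[i]]_(urep_dim u, r)) : (0 < r)%N ->
  V^t* *m V = 1%:M ->
  mxC G (V *m V^t*) *m u = u *m mxC G (V *m V^t*) ->
  exists v, exists e : urep_dim v = r,
    let V' := castmx (erefl, esym e) V in
    V'^t* *m V' = 1%:M /\ V' *m V'^t* = V *m V^t* /\ u *m mxC G V' = mxC G V' *m v.
Proof.
move=> r0 V1 Vu; pose v := mxC G (V^t*) *m u *m mxC G V.
have vD : corep v.
  by apply: corep_compress; [exact: urep_corep | exact: Vu | rewrite -mulmxA V1 mulmx1].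
have uV : u *m mxC G V = mxC G V *m v.
  rewrite /v !mulmxA -mxC_mul Vu -mulmxA -mxC_mul -mulmxA V1 mulmx1 //.
have sv : mxstar v = mxC G (V^t*) *m mxstar u *m mxC G V.
  by rewrite /v !mxstarM !mxstarC trmxCK mulmxA.
have vi : mxstar v *m v = 1%:M.
  rewrite sv -mulmxA -uV -mulmxA (mulmxA (mxstar u)) urep_isometry mul1mx.
  by rewrite -mxC_mul V1 mxC1.
have vv : v *m mxstar v = 1%:M.
  rewrite sv !mulmxA /v -(mulmxA _ (mxC G V)) -mxC_mul -(mulmxA _ u) -Vu.
  rewrite !mulmxA -mxC_mul mulmxA V1 mul1mx -(mulmxA _ u) urep_coisometry mulmx1.
  by rewrite -mxC_mul V1 mxC1.
exists (Urep (And4 r0 vi vv vD)), erefl => /=.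
by rewrite castmx_id.
Qed.

Lemma irreducible_sub v : exists p, Irr p /\
  exists V : 'M[R[i]]_(urep_dim v, rep_dim p),
    V^t* *m V = 1%:M /\ (v : 'M[G]_(urep_dim v)) *m mxC G V = mxC G V *m repr p.
Proof.
have [n] := ubnP (urep_dim v); elim: n v => // n IH v; rewrite ltnS => vn.
have [vI|] := pselect (irreducible_urep v).
  exists (rep_class v); split; first exact: Irr_class.
  have [T [T1 T2 Tv]] := repr_class v.
  by exists T; split.
move=> /existsNP [P] /not_implyP [PP] /not_implyP [Pa] /not_implyP [vP].
move=> /not_orP [P0 P1].
have Pv := reducing haar PP Pa vP.
have [r [V [V1 VP]]] := proj_isometry PP Pa.
have r0 : (0 < r)%N.
  case: r V V1 VP => // V V1 VP; case: P0; rewrite -VP.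
  by rewrite [V]thinmx0 mul0mx.
have rv : (r < urep_dim v)%N.
  rewrite ltn_neqAle (mulmx1_min V1) andbT; apply/eqP => rv.
  by apply: P1; rewrite -VP; apply: mulmx1_sq V1.
have [|w [e [W1 [WV Ww]]]] := @subrep v r V r0 V1; first by rewrite VP.
have [|p [pI [X [X1 Xw]]]] := IH w; first by rewrite e (leq_trans rv).
move: (castmx _ _) W1 WV Ww => W W1 WV Ww.
exists p; split=> //; exists (W *m X); split.
  by rewrite adjmxM mulmxA -(mulmxA _ _ W) W1 mulmx1.
by rewrite mxC_mul mulmxA Ww -mulmxA Xw mulmxA.
Qed.

(** The pairs are dependent because the domain of an isometry varies with its class. When [P] is a
    projection the ranges are mutually orthogonal, as their projections sum to [P]. *)
Definition constituents u (L : seq {p : Rep G & 'M[R[i]]_(urep_dim u, rep_dim p)})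
    (P : 'M[R[i]]_(urep_dim u)) : Prop :=
  (forall x, x \in L -> [/\ Irr (tag x), (tagged x)^t* *m tagged x = 1%:M
    & (u : 'M[G]_(urep_dim u)) *m mxC G (tagged x) = mxC G (tagged x) *m repr (tag x)]) /\
  \sum_(x <- L) tagged x *m (tagged x)^t* = P.

(** Induction on the rank: an irreducible inside the range of [V], embedded by Y, is split off, and
    V V^* - Y Y^* is again a projection commuting with [u], of smaller trace. *)
Lemma decompose_proj u r (V : 'M[R[i]]_(urep_dim u, r)) :
  V^t* *m V = 1%:M ->
  mxC G (V *m V^t*) *m u = u *m mxC G (V *m V^t*) ->
  exists L, constituents L (V *m V^t*).
Proof.
have [n] := ubnP r; elim: n r V => // n IH r V; rewrite ltnS => rn V1 Vu.
have [r0|r0] := posnP r.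
  exists [::]; split=> //; rewrite big_nil; move: r0 => r0; subst r.
  by rewrite [V]thinmx0 mul0mx.
have [w [e [W1 [WV Ww]]]] := subrep r0 V1 Vu.
have [p [pI [X [X1 Xw]]]] := irreducible_sub w.
move: (castmx _ _) W1 WV Ww => W W1 WV Ww.
pose Y := W *m X.
have Y1 : Y^t* *m Y = 1%:M.
  by rewrite adjmxM mulmxA -(mulmxA _ _ W) W1 mulmx1.
have Yu : u *m mxC G Y = mxC G Y *m repr p.
  by rewrite mxC_mul mulmxA Ww -mulmxA Xw mulmxA.
have PY : V *m V^t* *m Y = Y by rewrite -WV /Y mulmxA -(mulmxA W) W1 mulmx1.
clearbody Y.
have YP : Y^t* *m (V *m V^t*) = Y^t*.
  by rewrite -[in RHS]PY !adjmxM trmxCK.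
pose P := V *m V^t* - Y *m Y^t*.
have YYY : Y *m Y^t* *m (Y *m Y^t*) = Y *m Y^t*.
  by rewrite mulmxA -(mulmxA Y) Y1 mulmx1.
have PP : P *m P = P.
  have VV : V *m V^t* *m (V *m V^t*) = V *m V^t* by rewrite mulmxA -(mulmxA V) V1 mulmx1.
  rewrite /P mulmxBr !mulmxBl VV YYY (mulmxA _ Y) PY -(mulmxA Y) YP subrr subr0 //.
have Pa : P^t* = P by rewrite adjmxB !adjmxM !trmxCK.
have [r' [V' [V'1 V'P]]] := proj_isometry PP Pa.
have Ya := intertwiner_adj (esym Yu).
have [||L [L1 L2]] := IH r' V' _ V'1.
- apply: leq_trans rn; rewrite -(ltr_nat R[i]) -[X in X < _]mxtrace1 -[X in _ < X]mxtrace1.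
  rewrite -V'1 -V1 mxtrace_mulC V'P [X in _ < X]mxtrace_mulC /P raddfB /=.
  rewrite ltrBlDr ltrDl mxtrace_mulC Y1 mxtrace1 ltr0n; exact: urep_dim_gt0.
- rewrite V'P /P mxCB mulmxBl mulmxBr Vu; congr (_ - _).
  by rewrite mxC_mul -mulmxA Ya mulmxA -Yu -mulmxA.
exists (Tagged _ Y :: L); split.
  by move=> x; rewrite inE => /orP[/eqP->//|]; exact: L1.
by rewrite big_cons /= L2 V'P /P addrC subrK.
Qed.

Lemma complete_reducibility p : exists n (q : 'I_n.+1 -> Rep G),
  (forall i, Irr (q i)) /\ p = rep_sum q.
Proof.
have [||L [L1 L2]] := @decompose_proj (repr p) _ 1%:M.
- by rewrite adjmx1 mulmx1.
- by rewrite adjmx1 mulmx1 mxC1 mul1mx mulmx1.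
rewrite adjmx1 mulmx1 in L2.
case: L L1 L2 => [_|x L L1 L2].
  rewrite big_nil => /matrixP/(_ (Ordinal (urep_dim_gt0 (repr p))) (Ordinal (urep_dim_gt0 (repr p)))) /eqP.
  by rewrite !mxE eqxx eq_sym oner_eq0.
have inL (i : 'I_(size L).+1) : nth x (x :: L) i \in x :: L by rewrite mem_nth.
exists (size L), (fun i => tag (nth x (x :: L) i)); split.
  by move=> i; have [] := L1 _ (inL i).
rewrite -[LHS]reprK_class.
apply: (@rep_sum_intro (repr p) _ _ (fun i => tagged (nth x (x :: L) i))).
- by move=> i; have [] := L1 _ (inL i).
- by rewrite -L2 (big_nth x) big_mkord.
- by move=> i; have [] := L1 _ (inL i).
Qed.

End Decomposition.
End RepTheory.

(** * Characters *)
Section Span.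
Context (R : realType) (A : lmodType R[i]) (S : set A).

Lemma lspan0 : lspan S 0.
Proof. by exists 0%N, (fun=> 0), (fun=> 0); split=> [[]//|]; rewrite big_ord0. Qed.

Lemma lspan_cons (k : R[i]) v w : S v -> lspan S w -> lspan S (k *: v + w).
Proof.
move=> Sv [n [c [f [Sf ->]]]].
exists n.+1, (fun i => oapp c k (unlift ord0 i)), (fun i => oapp f v (unlift ord0 i)).
split=> [i|]; first by case: (unlift _ _) => /=.
rewrite big_ord_recl unlift_none /=; congr (_ + _).
by apply: eq_bigr => i _; rewrite liftK.
Qed.

Lemma lspanP (k : R[i]) v w : lspan S v -> lspan S w -> lspan S (k *: v + w).
Proof.
move=> Sv Sw; elim/lspan_ind: Sv => [|l v' w' Sv' IH].
  by rewrite scaler0 add0r.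
by rewrite scalerDr scalerA -addrA; exact: lspan_cons.
Qed.

Lemma lspanD v w : lspan S v -> lspan S w -> lspan S (v + w).
Proof. by move=> Sv; rewrite -[v]scale1r; exact: lspanP. Qed.

Lemma lspanZ (k : R[i]) v : lspan S v -> lspan S (k *: v).
Proof. by move=> Sv; rewrite -[_ *: _]addr0; apply: lspanP Sv lspan0. Qed.

Lemma lspan_gen v : S v -> lspan S v.
Proof. by move=> Sv; rewrite -[v]scale1r -[_ *: _]addr0; apply: lspan_cons Sv lspan0. Qed.

Lemma lspan_sum I (r : seq I) (F : I -> A) :
  (forall i, lspan S (F i)) -> lspan S (\sum_(i <- r) F i).
Proof. by move=> SF; elim/big_ind: _ => //; [exact: lspan0 | exact: lspanD]. Qed.

End Span.

Section Characters.
Context (R : realType) (G : cqg R) (h : {scalar G}) (haar : is_haar h).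
Implicit Types (u v w : urep G) (p q : Rep G).

Let h_state : is_state h. Proof. by case: haar. Qed.

Lemma rep_neq p q : p != q -> ~ uequiv (repr p) (repr q).
Proof.
by move=> pq /rep_classP; rewrite !reprK_class => e; rewrite e eqxx in pq.
Qed.

Lemma chi_orth p q : Irr p -> Irr q -> h (star (chi p) * chi q) = (p == q)%:R.
Proof.
move=> pI qI; rewrite /chi /mxtrace star_sum mulr_suml linear_sum /=.
under eq_bigr do rewrite mulr_sumr linear_sum /=.
have [<-|pq] := eqVneq p q; last first.
  rewrite big1// => i _; rewrite big1// => j _.
  by apply: (haar_orth haar pI qI); apply: rep_neq; rewrite eq_sym.
have [E [_ _ E1 EE]] := haar_orth_left haar pI.
rewrite -[RHS]E1; apply: eq_bigr => i _; rewrite (bigD1 i)//= big1 ?addr0.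
  by rewrite EE eqxx mul1r.
by move=> j ji; rewrite EE eq_sym (negbTE ji) mul0r.
Qed.

Lemma triv_is_urep : is_urep (1%:M : 'M[G]_1).
Proof.
have s1 : mxstar (1%:M : 'M[G]_1) = 1%:M.
  by apply/matrixP => i j; rewrite !mxE !ord1 star1.
split; rewrite ?s1 ?mulmx1// => i j; rewrite !ord1 big_ord1 !mxE eqxx mulr1n.
by rewrite rmorph1 (mint_one (tens2_min G)).
Qed.

Definition triv : Rep G := rep_class (Urep triv_is_urep).

Lemma triv_irr : Irr triv.
Proof.
apply: Irr_class => /= P PP _ _.
rewrite [P]mx11_scalar in PP *.
have /eqP := congr1 (fun M : 'M[R[i]]_1 => M 0 0) PP.
rewrite -scalar_mxM !mxE eqxx !mulr1n -subr_eq0 -{3}[P 0 0]mulr1 -mulrBr mulf_eq0.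
rewrite subr_eq0 => /orP[] /eqP ->; [left|by right].
by apply/matrixP => i j; rewrite !mxE mul0rn.
Qed.

Lemma chi_triv : chi triv = 1.
Proof. by rewrite chi_class /mxtrace big_ord1 mxE eqxx. Qed.

Lemma haar_chi p : Irr p -> h (chi p) = (p == triv)%:R.
Proof.
by move=> pI; have := chi_orth triv_irr pI; rewrite chi_triv star1 mul1r eq_sym.
Qed.

(* A unitary conjugate of p is irreducible because its character has L^2-norm 1. *)
Lemma conj_irr p : Irr p -> exists q, Irr q /\ chi q = star (chi p).
Proof.
move=> pI; have [v vE] := conj_urep haar pI.
have [n [q [qI qE]]] := complete_reducibility haar (rep_class v).
have cE : star (chi p) = \sum_i chi (q i) by rewrite -chi_sum -qE chi_class vE.
suff n0 : n = 0%N.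
  subst n; exists (q ord0); split=> //.
  by rewrite cE big_ord1.
have : h (chi p * star (chi p)) = 1.
  have [E [E1 EE]] := haar_orth_right haar pI.
  rewrite /chi /mxtrace star_sum mulr_suml linear_sum /= -[RHS]E1.
  apply: eq_bigr => i _; rewrite mulr_sumr linear_sum (bigD1 i)//= big1 ?addr0.
    by rewrite EE eqxx mul1r.
  by move=> j ji; rewrite EE eq_sym (negbTE ji) mul0r.
rewrite -{1}[chi p]starK cE star_sum mulr_suml linear_sum /=.
under eq_bigr => i _.
  rewrite mulr_sumr linear_sum /=.
  under eq_bigr => j _ do rewrite chi_orth//.
  rewrite -natr_sum; over.
rewrite -natr_sum => /eqP; rewrite pnatr_eq1 => /eqP e.
(* The sum of all (q i == q j) equals 1, while its diagonal alone contributes n.+1. *)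
suff : (n.+1 <= 1)%N by case: n {q qI qE cE e}.
rewrite -[X in (_ <= X)%N]e -[X in (X <= _)%N]card_ord -sum1_card; apply: leq_sum => i _.
by rewrite (bigD1 i)//= eqxx.
Qed.

(** By [orth_form] the squared length of an entry of x u is the same in every column, so one null
    entry makes the whole row null. *)
Lemma haar_row_sq u (x : 'rV[R[i]]_(urep_dim u)) c : irreducible_urep u ->
  h (star ((mxC G x *m u) 0 c) * (mxC G x *m u) 0 c) = 0 -> x = 0.
Proof.
move=> uI x0; have [E [_ _ _ EE]] := haar_orth_left haar uI.
apply: (row_null haar) => b l; apply: (state_null haar).
by rewrite (orth_form x l EE) -(orth_form x c EE).
Qed.

Lemma orth_family_bound r N (f : 'I_r -> G) (e : 'I_N -> G) (D : 'M[R[i]]_(r, N)) :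
  (forall i j, i != j -> h (star (f i) * f j) = 0) ->
  (forall i, h (star (f i) * f i) != 0) ->
  (forall i, f i = \sum_k D i k *: e k) -> (r <= N)%N.
Proof.
move=> orth nz fE; suff : row_free D by move=> /eqP <-; exact: rank_leq_col.
rewrite -kermx_eq0; apply/rowV0P => x /sub_kermxP xD; apply/rowP => j.
have : \sum_i x 0 i *: f i = 0.
  under eq_bigr => i _ do rewrite fE scaler_sumr.
  rewrite exchange_big big1// => k _ /=.
  under eq_bigr => i _ do rewrite scalerA.
  rewrite -scaler_suml.
  have := congr1 (fun M : 'rV[R[i]]_N => M 0 k) xD; rewrite !mxE => ->.
  by rewrite scale0r.
move/(congr1 (fun a => h (star (f j) * a))); rewrite mulr0 linear0 mulr_sumr linear_sum /=.
rewrite (bigD1 j)//= big1 ?addr0 => [|i ij].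
  by rewrite -scalerAr stateZ => /eqP; rewrite mulf_eq0 (negbTE (nz j)) orbF mxE => /eqP.
by rewrite -scalerAr stateZ orth ?mulr0// eq_sym.
Qed.

(* If h(u_ij^* v_aa w_kl) is nonzero then u occurs in v (x) w; rewriting the
   intertwining relation, some nonzero combination of the coefficients of v lies
   in the span of the products u_jn w_ls^*. *)
Lemma coef_in_span u w v i j k l : irreducible_urep v ->
  h (star (u i j) * \tr (v : 'M[G]_(urep_dim v)) * w k l) != 0 ->
  exists (x : 'rV[R[i]]_(urep_dim v)) c (D : 'M[R[i]]_(urep_dim u, urep_dim w)),
    x != 0 /\ (mxC G x *m v) 0 c = \sum_n \sum_s D n s *: (u j n * star (w l s)).
Proof.
move=> vI nz.
have [a na] : exists a, h (star (u i j) * v a a * w k l) != 0.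
  apply/existsP; apply: contra_neqT nz => /existsPn H.
  rewrite /mxtrace mulr_sumr mulr_suml linear_sum big1// => a _ /=.
  by have := H a; rewrite negbK => /eqP.
pose t := Urep (tensmx_is_urep v w).
pose Y := \matrix_(b, L) h (star (u i b) * t (mxtens_index (a, k)) L).
have Yt : mxC G Y *m t = u *m mxC G Y := haar_intertwiner haar u t i _.
pose x : 'rV[R[i]]_(urep_dim v) := \row_b Y j (mxtens_index (b, l)).
pose c : 'I_(urep_dim v) := Ordinal (urep_dim_gt0 v).
exists x, c, (\matrix_(n, s) Y n (mxtens_index (c, s))); split.
  apply: contra_neq na => /rowP /(_ a); rewrite [x _ _]mxE [Y _ _]mxE [in X in _ = X -> _]mxE /= tensmxE => <-.
  by rewrite mulrA.
have H s : \sum_b \sum_l' Y j (mxtens_index (b, l')) *: (v b c * w l' s) =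
    \sum_n Y n (mxtens_index (c, s)) *: u j n.
  have /matrixP/(_ j (mxtens_index (c, s))) := Yt.
  rewrite mxC_mulE mul_mxCE sum_tens => <-.
  by apply: eq_bigr => b _; apply: eq_bigr => l' _; rewrite tensmxE.
(* The relation [H] is multiplied by w_ls^* and summed over s; w w^* = 1 keeps only l' = l. *)
transitivity (\sum_s (\sum_n Y n (mxtens_index (c, s)) *: u j n) * star (w l s)).
  under eq_bigr => s _ do rewrite -H mulr_suml.
  rewrite exchange_big mxC_mulE; apply: eq_bigr => b _ /=.
  under eq_bigr => s _ do rewrite mulr_suml.
  rewrite exchange_big (bigD1 l)//= [X in _ + X]big1 ?addr0 => [|l' l'l].
    under eq_bigr => s _ do rewrite -scalerAl -mulrA.
    rewrite -scaler_sumr -mulr_sumr; have /mxstar_mulr -> := urep_coisometry w.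
    by rewrite eqxx mulr1 mxE.
  under eq_bigr => s _ do rewrite -scalerAl -mulrA.
  rewrite -scaler_sumr -mulr_sumr; have /mxstar_mulr -> := urep_coisometry w.
  by rewrite (negbTE l'l) mulr0 scaler0.
rewrite [RHS]exchange_big; apply: eq_bigr => s _ /=.
rewrite mulr_suml; apply: eq_bigr => n _; by rewrite -scalerAl mxE.
Qed.

(** A dimension count: each such class yields, by [coef_in_span], a non-null combination of its
    coefficients in the span of the dim u * dim w products u_jn w_ls^*. Combinations for different
    classes are orthogonal, which bounds the number of classes. *)
Lemma coef_finite u w i j k l :
  finite_set [set p | Irr p /\ h (star (u i j) * chi p * w k l) != 0].
Proof.
apply: contrapT => /infinite_set_fset - /(_ (urep_dim u * urep_dim w).+1) [B BA].
apply/negP; rewrite -leqNgt.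
pose zP p (zD : G * 'M[R[i]]_(urep_dim u, urep_dim w)) :=
  (exists (x : 'rV[R[i]]_(urep_dim (repr p))) c, x != 0 /\ zD.1 = (mxC G x *m repr p) 0 c) /\
  zD.1 = \sum_n \sum_s zD.2 n s *: (u j n * star (w l s)).
have /choice [f fP] : forall p, exists zD, p \in B -> zP p zD.
  move=> p; have [pB|//] := boolP (p \in B); last by exists (0, 0).
  have /= [pI nz] := BA p pB.
  have [x [c [D [x0 zE]]]] := coef_in_span pI nz.
  by exists ((mxC G x *m repr p) 0 c, D) => _; split=> //; exists x, c.
have Bi (a : 'I_(size B)) : tnth (in_tuple B) a \in B by exact: mem_tnth.
apply: (@orth_family_bound _ _ (fun i => (f (tnth (in_tuple B) i)).1)
  (fun k => u j (mxtens_unindex k).1 * star (w l (mxtens_unindex k).2))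
  (\matrix_(i, k) (f (tnth (in_tuple B) i)).2 (mxtens_unindex k).1 (mxtens_unindex k).2)).
- move=> a b ab.
  have [[x [c [_ ->]]] _] := fP _ (Bi a); have [[y [d [_ ->]]] _] := fP _ (Bi b).
  rewrite !mxC_mulE star_sum mulr_suml linear_sum big1// => i' _.
  rewrite mulr_sumr linear_sum big1// => j' _ /=.
  rewrite state_sesqui (haar_orth haar) ?mulr0//.
  + by have [] := BA _ (Bi a).
  + by have [] := BA _ (Bi b).
  apply: rep_neq; apply: contra_neq ab => /eqP.
  rewrite eq_sym !(tnth_nth triv) nth_uniq ?fset_uniq//; first by move/eqP/val_inj.
- move=> a; have [[x [c [x0 ->]]] _] := fP _ (Bi a).
  apply: contra_neq x0; apply: haar_row_sq.
  by have [] := BA _ (Bi a).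
- move=> a; have [_ {1}->] := fP _ (Bi a).
  rewrite sum_tens; apply: eq_bigr => n _; apply: eq_bigr => s _.
  by rewrite !mxE !mxtens_indexK.
Qed.

End Characters.

(** * The norm of a character *)
(** Bernoulli's inequality makes (a / b)^n unbounded when a > b. Only the exponents 2^k occur, since
    repeated Cauchy-Schwarz doubles the exponent. *)
Lemma pow2_bound (R : realType) (a b K : R) : 0 <= a -> 0 <= b ->
  (forall k, a ^+ (2 ^ k) <= K * b ^+ (2 ^ k)) -> a <= b.
Proof.
move=> a0 b0 H; rewrite leNgt; apply/negP => ba.
have a_gt0 : 0 < a := le_lt_trans b0 ba.
have [b_eq0|b_neq0] := eqVneq b 0.
  by have := H 0%N; rewrite b_eq0 expn0 !expr1 mulr0 leNgt a_gt0.
have b_gt0 : 0 < b by rewrite lt_neqAle eq_sym b_neq0.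
pose d := a / b - 1.
have d0 : 0 < d by rewrite subr_gt0 ltr_pdivlMr ?mul1r.
have abE : a / b = 1 + d by rewrite /d addrC subrK.
have bern n : 1 + n%:R * d <= (a / b) ^+ n.
  elim: n => [|n IH]; first by rewrite mul0r addr0 expr0.
  rewrite exprS; apply: le_trans (ler_wpM2l _ IH); last by rewrite divr_ge0.
  by rewrite abE -natr1; have := ler0n R n; nra.
have HK k : 1 + (2 ^ k)%:R * d <= K.
  apply: le_trans (bern _) _; rewrite expr_div_n ler_pdivrMr ?exprn_gt0//.
have := HK (Num.bound `|K / d|).
apply/negP; rewrite -ltNge.
have : K / d < (2 ^ Num.bound `|K / d|)%:R.
  apply: le_lt_trans (ler_norm _) _.
  apply: lt_le_trans (archi_boundP (normr_ge0 _)) _.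
  by rewrite ler_nat; exact/ltnW/ltn_expl.
by rewrite ltr_pdivrMr//; lra.
Qed.

Section CharacterNorm.
Context (R : realType) (G : cqg R) (h : {scalar G}) (haar : is_haar h).
Implicit Types (p q : Rep G) (a b z : G).

Let h_state : is_state h. Proof. by case: haar. Qed.

Definition chars : set G := lspan [set a | exists2 p, Irr p & a = chi p].

Definition sqn a : R := complex.Re (h (star a * a)).

Lemma sqnE a : h (star a * a) = (sqn a)%:C%C.
Proof. exact/ge0_Re/h_state.2. Qed.

Lemma sqn_ge0 a : 0 <= sqn a.
Proof. by rewrite -lecR -sqnE; exact: h_state.2. Qed.

Lemma sqn_CS a b : `|h (star a * b)| ^+ 2 <= (sqn a * sqn b)%:C%C.
Proof. by rewrite rmorphM /= -!sqnE; exact: state_CS. Qed.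

Lemma norm2E a : norm2 h a ^+ 2 = sqn a.
Proof. by rewrite sqr_sqrtr ?sqn_ge0. Qed.

Lemma norm2_ge0 a : 0 <= norm2 h a.
Proof. exact: sqrtr_ge0. Qed.

Lemma sqnZ (k : R[i]) a : (sqn (k *: a))%:C%C = `|k| ^+ 2 * (sqn a)%:C%C.
Proof. by rewrite -!sqnE state_sesqui normCK mulrC [k * _]mulrC mulrC. Qed.

Lemma Pol_finite a b : Pol a -> Pol b ->
  finite_set [set p | Irr p /\ h (star a * chi p * b) != 0].
Proof.
move=> aP; move: b; apply: lspan_ind => [|k v w [p [pI [i [j ->]]]] IH].
  rewrite (_ : [set _ | _] = set0) ?finite_set0 //.
  by rewrite -subset0 => q [_]; rewrite mulr0 linear0 eqxx.
apply: (sub_finite_set (B :=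
    [set q | Irr q /\ h (star a * chi q * (repr p : urep G) i j) != 0]
    `|` [set q | Irr q /\ h (star a * chi q * w) != 0])).
  move=> q [qI]; rewrite mulrDr -scalerAr linearD /= stateZ => nz.
  have [e|] := eqVneq (h (star a * chi q * w)) 0; last by right.
  left; split=> //; apply: contra_neq nz => ->; rewrite e mulr0 addr0 //.
rewrite finite_setU; split => //.
elim/lspan_ind: aP => [|k' v' w' [p' [p'I [i' [j' ->]]]] IH'].
  rewrite (_ : [set _ | _] = set0) ?finite_set0 //.
  by rewrite -subset0 => q [_]; rewrite star0 !mul0r linear0 eqxx.
apply: (sub_finite_set (B :=
    [set q | Irr q /\ h (star ((repr p' : urep G) i' j') * chi q * (repr p : urep G) i j) != 0]
    `|` [set q | Irr q /\ h (star w' * chi q * (repr p : urep G) i j) != 0])).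
  move=> q [qI]; rewrite starD starZ !mulrDl -!scalerAl linearD /= stateZ => nz.
  have [e|] := eqVneq (h (star w' * chi q * (repr p : urep G) i j)) 0; last by right.
  left; split=> //; apply: contra_neq nz => ->; rewrite e mulr0 addr0 //.
by rewrite finite_setU; split => //; exact: coef_finite.
Qed.

(** A combination z of characters has the coefficients h(chi_p^* z), each at most |z|_2 in modulus,
    and by [Pol_finite] only a finite list of p, depending on [b] alone, contributes. The constant
    is the square of the sum of |h(b^* chi_p b)| over that list. *)
Lemma chars_compress_bound b : Pol b ->
  exists2 C : R, 0 <= C & forall z, chars z ->
    `|h (star b * z * b)| ^+ 2 <= (C * sqn z)%:C%C.
Proof.
move=> bP; have /finite_seqP [s0 s0E] := Pol_finite bP bP.
pose s := undup s0.
have sE p : (p \in s) = `[< Irr p /\ h (star b * chi p * b) != 0 >].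
  rewrite mem_undup; apply/idP/asboolP;
    by rewrite -[_ /\ _]/([set p | Irr p /\ h (star b * chi p * b) != 0] p) s0E.
have zE z : chars z -> h (star b * z * b) =
    \sum_(p <- s) h (star (chi p) * z) * h (star b * chi p * b).
  elim/lspan_ind => [|k v w [q qI ->] IH].
    rewrite mulr0 mul0r linear0 big1// => p _.
    by rewrite mulr0 linear0 mul0r.
  rewrite mulrDr mulrDl -scalerAr -scalerAl linearD /= stateZ IH.
  under [RHS]eq_bigr => p _ do
    rewrite mulrDr -scalerAr linearD /= stateZ mulrDl -(mulrA k).
  rewrite big_split; congr (_ + _); rewrite -mulr_sumr; congr (_ * _).
  have [qs|qs] := boolP (q \in s).
    rewrite (bigD1_seq q)//= ?undup_uniq// chi_orth// eqxx mul1r.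
    rewrite big_seq_cond big1 ?addr0// => p /andP[].
    by rewrite sE => /asboolP [pI _] pq; rewrite chi_orth// (negbTE pq) mul0r.
  rewrite big_seq big1 => [|p ps]; last first.
    move: (ps); rewrite sE => /asboolP [pI _]; rewrite chi_orth//.
    by have [e|] := eqVneq p q; rewrite ?mul0r//; rewrite -e ps in qs.
  apply/eqP; apply: contraNT qs => nz; rewrite sE; exact/asboolP.
have [r rE] : exists r : Rep G -> R, forall p, `|h (star b * chi p * b)| = (r p)%:C%C.
  by exists (fun p => complex.Re `|h (star b * chi p * b)|) => p; rewrite -ge0_Re.
pose C := \sum_(p <- s) r p.
exists (C ^+ 2) => [|z zc]; [exact: sqr_ge0 | rewrite zE//].
have bnd : `|\sum_(p <- s) h (star (chi p) * z) * h (star b * chi p * b)| <=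
    (Num.sqrt (sqn z) * C)%:C%C.
  apply: le_trans (ler_norm_sum _ _ _) _.
  rewrite /C mulr_sumr rmorph_sum /= big_seq [leRHS]big_seq; apply: ler_sum => p.
  rewrite sE => /asboolP [pI _]; rewrite normrM rE rmorphM /=.
  rewrite ler_wpM2r -?rE// -(@ler_pXn2r _ 2)// ?nnegrE ?lecR ?sqrtr_ge0//.
  have -> : (Num.sqrt (sqn z))%:C%C ^+ 2 = (sqn z)%:C%C.
    by rewrite -rmorphXn /= sqr_sqrtr ?sqn_ge0.
  apply: le_trans (sqn_CS _ _) _.
  have -> : sqn (chi p) = 1.
    by rewrite /sqn chi_orth// eqxx.
  by rewrite mul1r.
have b0 : 0 <= Num.sqrt (sqn z) * C.
  by rewrite -lecR; exact: le_trans (normr_ge0 _) bnd.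
apply: (@le_trans _ _ ((Num.sqrt (sqn z) * C)%:C%C ^+ 2)).
  by rewrite ler_pXn2r// ?nnegrE// (le_trans _ bnd).
by rewrite -rmorphXn /= exprMn sqr_sqrtr ?sqn_ge0// mulrC.
Qed.

(* The operator norm of x on a subspace H of characters, invariant under x and
   x^*, bounds the operator norm of x on L^2(G): if y = x^* x then
   h(b^* y^n b) is at most a constant times |y^n|_2 <= M^(2n), while it grows
   at least like (h(b^* y b) / h(b^* b))^n. *)
Lemma chars_norm_bound (H : set G) x (M : R) : H `<=` chars -> H 1 ->
  (forall a, H a -> H (x * a)) -> (forall a, H a -> H (star x * a)) ->
  0 <= M -> (forall a, H a -> sqn (x * a) <= M * sqn a) ->
  forall b, Pol b -> sqn (x * b) <= M * sqn b.
Proof.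
move=> Hc H1 Hx Hsx M0 HM b bP.
(* Cauchy-Schwarz for a and x x^* a passes the bound from [x] to its adjoint on [H]. *)
have HsM a : H a -> sqn (star x * a) <= M * sqn a.
  move=> Ha.
  have := sqn_CS a (x * (star x * a)).
  have -> : star a * (x * (star x * a)) = star (star x * a) * (star x * a).
    by rewrite starM starK !mulrA.
  rewrite sqnE ger0_norm ?lecR ?sqn_ge0// -rmorphXn /= lecR => CS.
  have := HM _ (Hsx _ Ha).
  have := sqn_ge0 a; have := sqn_ge0 (star x * a) => s0 a0 le.
  have [->|sn0] := eqVneq (sqn (star x * a)) 0; first by rewrite mulr_ge0.
  have sgt0 : 0 < sqn (star x * a) by rewrite lt_neqAle eq_sym sn0.
  rewrite -(ler_pM2l sgt0) -expr2; apply: le_trans CS _.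
  have := ler_wpM2l a0 le; lra.
pose y := star x * x.
have sy n : star (y ^+ n) = y ^+ n.
  elim: n => [|n IH]; first by rewrite expr0 star1.
  by rewrite exprS starM IH /y starM starK -exprSr exprS.
have Hy n : H (y ^+ n).
  by elim: n => [//|n IH]; rewrite exprS /y -mulrA; exact/Hsx/Hx.
have yM n : sqn (y ^+ n) <= (M ^+ 2) ^+ n.
  elim: n => [|n IH].
    by rewrite !expr0 /sqn star1 mulr1 h_state.1.
  have -> : y ^+ n.+1 = star x * (x * y ^+ n) by rewrite exprS mulrA.
  apply: le_trans (HsM _ (Hx _ (Hy n))) _.
  apply: (@le_trans _ _ (M * (M * sqn (y ^+ n)))).
    by rewrite ler_wpM2l// HM.
  by rewrite mulrA -expr2 [leRHS]exprS ler_wpM2l ?sqr_ge0.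
have [C C0 HC] := chars_compress_bound bP.
(* With this shift, m k = h(b^* y^(2^k) b) also for k = 0, where [x] stands in for a square root of
   [y]. *)
pose z k := if k is k'.+1 then y ^+ (2 ^ k') * b else x * b.
pose m k := sqn (z k).
have mE k : h (star b * y ^+ (2 ^ k) * b) = (m k)%:C%C.
  rewrite /m -sqnE; case: k => [|k] /=; first by rewrite expn0 expr1 /y starM !mulrA.
  by rewrite starM sy expnS mul2n -addnn exprD !mulrA.
have mS k : m k ^+ 2 <= sqn b * m k.+1.
  have := sqn_CS b (y ^+ (2 ^ k) * b).
  by rewrite mulrA mE ger0_norm ?lecR ?sqn_ge0// -rmorphXn /= lecR.
have mC k : m k ^+ 2 <= C * (M ^+ 2) ^+ (2 ^ k).
  have := HC _ (Hc _ (Hy (2 ^ k)%N)).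
  rewrite mE ger0_norm ?lecR ?sqn_ge0// -rmorphXn /= lecR => /le_trans; apply.
  by rewrite ler_wpM2l.
have s0 := sqn_ge0 b.
have [s_eq0|s_neq0] := eqVneq (sqn b) 0.
  have := mS 0%N; rewrite s_eq0 mul0r mulr0 /m /= => le.
  have : sqn (x * b) ^+ 2 == 0 by rewrite eq_le le sqr_ge0.
  by rewrite sqrf_eq0 => /eqP ->.
have sgt0 : 0 < sqn b by rewrite lt_neqAle eq_sym s_neq0.
(* Iteration of [mS]: the ratio m 0 / |b|^2 raised to the power 2^k is at most m k / |b|^2. *)
have mpow k : m 0%N ^+ (2 ^ k) * sqn b <= sqn b ^+ (2 ^ k) * m k.
  elim: k => [|k IH]; first by rewrite expn0 !expr1 mulrC.
  have e (t : R) : t ^+ (2 ^ k.+1) = (t ^+ (2 ^ k)) ^+ 2 by rewrite expnS mulnC exprM.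
  rewrite !e -(ler_pM2r sgt0).
  set u := m 0%N ^+ _ in IH *; set v := sqn b ^+ (2 ^ k) in IH *.
  have -> : u ^+ 2 * sqn b * sqn b = (u * sqn b) ^+ 2 by ring.
  have -> : v ^+ 2 * m k.+1 * sqn b = v ^+ 2 * (sqn b * m k.+1) by ring.
  apply: (@le_trans _ _ ((v * m k) ^+ 2)).
    by rewrite ler_pXn2r// nnegrE ?mulr_ge0 ?exprn_ge0 ?sqn_ge0.
  by rewrite exprMn ler_wpM2l ?sqr_ge0.
rewrite -[sqn (x * b)]/(m 0%N).
rewrite -(@ler_pXn2r _ 2)// ?nnegrE ?mulr_ge0 ?sqn_ge0//.
(* [mpow] is squared because [mC] bounds the square of m k; the leftover factor C / |b|^4 does not
   depend on k. *)
apply: (pow2_bound (K := C / sqn b ^+ 2)) => [||k]; rewrite ?sqr_ge0//.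
rewrite -(ler_pM2r (exprn_gt0 2 sgt0)).
have -> : C / sqn b ^+ 2 * ((M * sqn b) ^+ 2) ^+ (2 ^ k) * sqn b ^+ 2 =
    (sqn b ^+ (2 ^ k)) ^+ 2 * (C * (M ^+ 2) ^+ (2 ^ k)).
  have -> : (M * sqn b) ^+ 2 = M ^+ 2 * sqn b ^+ 2 by ring.
  by rewrite exprMn [(sqn b ^+ 2) ^+ _]exprAC; field.
rewrite [(m 0%N ^+ 2) ^+ _]exprAC -exprMn; apply: (@le_trans _ _ ((sqn b ^+ (2 ^ k) * m k) ^+ 2)).
  by rewrite ler_pXn2r// nnegrE ?mulr_ge0 ?exprn_ge0 ?sqn_ge0.
by rewrite exprMn ler_wpM2l ?sqr_ge0.
Qed.

End CharacterNorm.

(** * Transfer along fusion rules *)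
Section NormTransfer.
Context (R : realType).

Lemma chars_Pol (G : cqg R) : @chars R G `<=` @Pol R G.
Proof.
move=> z; apply: lspan_ind => [|k v w [p pI ->] wP]; first exact: lspan0.
apply: lspanP wP; apply: lspan_sum => i.
by apply: lspan_gen; exists p; split=> //; exists i, i.
Qed.

Section Norm2.
Context (G : cqg R) (h : {scalar G}) (haar : is_haar h).

Lemma norm2Z (t : R) (a : G) : 0 <= t -> norm2 h (t%:C%C *: a) = t * norm2 h a.
Proof.
move=> t0; apply/eqP; rewrite -(@eqrXn2 _ 2)// ?mulr_ge0 ?norm2_ge0//.
rewrite exprMn !norm2E//; apply/eqP.
have := sqnZ haar t%:C%C a; rewrite ger0_norm ?lecR// -rmorphXn -rmorphM /=.
by case.
Qed.

Lemma norm_inftyP (x : G) (M : R) : (norm_infty h x <= M%:E)%E ->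
  forall b, Pol b -> norm2 h (x * b) <= M * norm2 h b.
Proof.
move=> xM b bP.
have H t : 0 <= t -> t * norm2 h b <= 1 -> t * norm2 h (x * b) <= M.
  move=> t0 tb; rewrite -norm2Z// scalerAr -lee_fin; apply: le_trans xM.
  apply: ereal_sup_ubound; exists (t%:C%C *: b) => //; split; first exact: lspanZ.
  by rewrite norm2Z.
have [b0|b0] := eqVneq (norm2 h b) 0.
  (* A null [b] cannot be normalized, but all its multiples lie in the unit ball, so a nonzero |x
     b|_2 would exceed [M] after scaling. *)
  rewrite b0 mulr0 leNgt; apply/negP => xb.
  have M0 : 0 <= M by have := H 0; rewrite !mul0r; apply.
  have t0 : 0 <= (M + 1) / norm2 h (x * b) by rewrite divr_ge0 ?(ltW xb)// addr_ge0.
  have := H _ t0; rewrite b0 mulr0 mulfVK ?gt_eqF// => /(_ ler01).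
  by rewrite gerDl ler10.
have bgt0 : 0 < norm2 h b by rewrite lt_neqAle eq_sym b0 norm2_ge0.
have := H (norm2 h b)^-1; rewrite mulVf// invr_ge0 ltW// => /(_ isT (lexx _)).
by rewrite mulrC ler_pdivrMr.
Qed.

End Norm2.

(** [J] stands for a state-preserving correspondence of characters, as a relation that can be
    reversed to obtain the opposite inequality. Lengths agree under [J], so the norm of x' bounds x
    on the domain of [J], and [chars_norm_bound] extends this bound to Pol(G1). *)
Lemma norm_infty_le (G1 G2 : cqg R) (h1 : {scalar G1}) (h2 : {scalar G2})
    (haar1 : is_haar h1) (haar2 : is_haar h2) (J : G1 -> G2 -> Prop) :
  J 1 1 ->
  (forall a b a' b', J a b -> J a' b' -> J (a * a') (b * b')) ->
  (forall a b, J a b -> J (star a) (star b)) ->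
  (forall a b, J a b -> h1 a = h2 b) ->
  (forall a b, J a b -> chars a) -> (forall a b, J a b -> chars b) ->
  forall x x', J x x' -> (norm_infty h1 x <= norm_infty h2 x')%E.
Proof.
move=> J1 JM JS Jh Jc1 Jc2 x x' Jx.
have sqnJ a b : J a b -> sqn h1 a = sqn h2 b.
  by move=> Jab; rewrite /sqn (Jh _ (star b * b))//; apply: JM => //; exact: JS.
have N0 : (0 <= norm_infty h2 x')%E.
  apply: ereal_sup_ubound; exists 0; first by split; [exact: lspan0|rewrite /norm2 mulr0 linear0 sqrtr0 ler01].
  by rewrite /norm2 !mulr0 linear0 sqrtr0.
case NE : (norm_infty h2 x') N0 => [M| |]; [|by move=> _; rewrite leey|by []].
rewrite lee_fin => M0.
have xM' : (norm_infty h2 x' <= M%:E)%E by rewrite NE.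
have bnd : forall b, Pol b -> sqn h1 (x * b) <= M ^+ 2 * sqn h1 b.
  apply: (chars_norm_bound haar1 (H := fun a => exists b, J a b)) => //.
  - by move=> a [b /Jc1].
  - by exists 1.
  - by move=> a [b Jab]; exists (x' * b); exact: JM.
  - by move=> a [b Jab]; exists (star x' * b); apply: JM => //; exact: JS.
  - by rewrite sqr_ge0.
  - move=> a [b Jab]; rewrite (sqnJ _ _ Jab) (sqnJ _ _ (JM _ _ _ _ Jx Jab)).
    rewrite -!(norm2E haar2) -exprMn ler_pXn2r ?nnegrE ?mulr_ge0 ?norm2_ge0//.
    by apply: (norm_inftyP haar2 xM'); exact/chars_Pol/(Jc2 _ _ Jab).
apply: ge_ereal_sup => _ [a [aP a1] <-]; rewrite lee_fin.
have := bnd a aP; rewrite -!(norm2E haar1) -exprMn.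
rewrite ler_pXn2r ?nnegrE ?mulr_ge0 ?norm2_ge0// => /le_trans; apply.
by rewrite -[leRHS]mulr1 ler_wpM2l.
Qed.

End NormTransfer.

Section Trivial.
Context (R : realType) (G : cqg R).
Implicit Types p q : Rep G.

Lemma rep_class_triv (u : urep G) : urep_dim u = 1%N ->
  \tr (u : 'M[G]_(urep_dim u)) = 1 -> rep_class u = triv G.
Proof.
case: u => n u uP /= n1; subst n => u1; apply/rep_classP.
have {}u1 : u = 1%:M by rewrite [u]mx11_scalar; move: u1; rewrite /mxtrace big_ord1 => ->.
exists 1%:M; rewrite /= adjmx1 !mulmx1; split=> //.
by rewrite u1 mxC1 !mul1mx.
Qed.

Lemma urep_dim1 (u : urep G) : urep_dim u = 1%N ->
  \tr (u : 'M[G]_(urep_dim u)) * star (\tr (u : 'M[G]_(urep_dim u))) = 1.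
Proof.
have := urep_coisometry u; case: u => n u uP /= + n1; subst n => /matrixP/(_ 0 0).
by rewrite !mxE big_ord1 !mxE /mxtrace big_ord1.
Qed.

Lemma triv_uniq p : rep_dim p = 1%N -> chi p = 1 -> p = triv G.
Proof. by move=> d1 c1; rewrite -[p]reprK_class; exact: rep_class_triv. Qed.

Lemma rep_dim_tens p q : rep_dim (rep_tens p q) = (rep_dim p * rep_dim q)%N.
Proof. by rewrite /rep_dim (uequiv_dim (repr_class _)). Qed.

Lemma tens_triv : rep_tens (triv G) (triv G) = triv G.
Proof.
apply: triv_uniq; last by rewrite chi_tens chi_triv mulr1.
by rewrite rep_dim_tens /rep_dim (uequiv_dim (repr_class _)).
Qed.

(** Comparing dimensions gives 1, and a unitary character with chi^2 = chi is 1. Since the condition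
    involves only the tensor product, a map preserving fusion fixes the trivial class. *)
Lemma idempotent_triv p : rep_tens p p = p -> p = triv G.
Proof.
move=> pp; have d1 : rep_dim p = 1%N.
  have := rep_dim_tens p p; rewrite pp => /eqP.
  rewrite -{1}[rep_dim p]muln1 eqn_pmul2l ?urep_dim_gt0// => /eqP //.
apply: triv_uniq => //.
have := chi_tens p p; rewrite pp => cc.
have : chi p * star (chi p) = 1.
  exact: urep_dim1.
by move=> e; rewrite -[LHS]mulr1 -e mulrA -cc.
Qed.

End Trivial.

(** A single list serves every module [V], so that sums in the two algebras can be compared term by
    term. *)
Lemma finite_support_seq (R : realType) (T : choiceType) (E : set T) (c : T -> R[i]) :
  finite_set [set p | E p /\ c p != 0] -> exists s : seq T,
    [/\ uniq s, forall p, p \in s <-> E p /\ c p != 0 &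
      forall (V : lmodType R[i]) (F : T -> V),
        \sum_(p \in E) c p *: F p = \sum_(p <- s) c p *: F p].
Proof.
move=> /finite_seqP [s0 sE]; exists (undup s0).
have ss p : (p \in undup s0) <-> E p /\ c p != 0.
  by rewrite mem_undup -[_ /\ _]/([set p | E p /\ c p != 0] p) sE.
split=> [|//|V F]; first exact: undup_uniq.
rewrite [RHS]fsbig_seq ?undup_uniq//; apply/esym; apply: fsbig_widen => [p /ss[]//|p [pE /= ps]].
have [->|cp] := eqVneq (c p) 0; first by rewrite scale0r.
by exfalso; apply: ps; apply/ss.
Qed.

Section Fusion.
Context (R : realType) (G1 G2 : cqg R) (h1 : {scalar G1}) (h2 : {scalar G2}).
Context (haar1 : is_haar h1) (haar2 : is_haar h2).
Context (Phi : Rep G1 -> Rep G2) (Phi_inj : injective Phi).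
Context (Phi_irr : forall p, Irr p -> Irr (Phi p)).
Context (Phi_tens : forall p q : Rep G1, Phi (rep_tens p q) = rep_tens (Phi p) (Phi q)).
Context (Phi_sum : forall (n : nat) (p : 'I_n.+1 -> Rep G1),
  Phi (rep_sum p) = rep_sum (fun i => Phi (p i))).

(* The *-isomorphism chi_p |-> chi_(Phi p) between character algebras, as a graph. *)
Definition fusion_graph (a : G1) (b : G2) : Prop :=
  lspan [set z : (G1 * G2)%type | exists2 p, Irr p & z = (chi p, chi (Phi p))] (a, b).

Lemma fusion_graph0 : fusion_graph 0 0.
Proof. exact: lspan0. Qed.

Lemma fusion_graphP (k : R[i]) a b a' b' : fusion_graph a b -> fusion_graph a' b' ->
  fusion_graph (k *: a + a') (k *: b + b').
Proof. exact: lspanP. Qed.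

Lemma fusion_graph_ind (P : G1 -> G2 -> Prop) : P 0 0 ->
  (forall (k : R[i]) p a b, Irr p -> P a b ->
     P (k *: chi p + a) (k *: chi (Phi p) + b)) ->
  forall a b, fusion_graph a b -> P a b.
Proof.
move=> P0 PS a b; pose Q (z : (G1 * G2)%type) := P z.1 z.2.
rewrite -[P a b]/(Q (a, b)); apply: lspan_ind => // k v [a' b'] [p pI ->] Qw.
exact: PS.
Qed.

Lemma fusion_graph_sum I (r : seq I) (F : I -> G1) (F' : I -> G2) :
  (forall i, fusion_graph (F i) (F' i)) ->
  fusion_graph (\sum_(i <- r) F i) (\sum_(i <- r) F' i).
Proof.
move=> H; elim/big_rec2: _ => [|i y x _ IH]; first exact: fusion_graph0.
by rewrite -[F i]scale1r -[F' i]scale1r; apply: fusion_graphP.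
Qed.

Lemma fusion_graph_irr p : Irr p -> fusion_graph (chi p) (chi (Phi p)).
Proof. by move=> pI; apply: lspan_gen; exists p. Qed.

(** Products of irreducible characters involve reducible classes; complete reducibility and
    additivity of [Phi] bring them into the graph. *)
Lemma fusion_graph_chi p : fusion_graph (chi p) (chi (Phi p)).
Proof.
have [n [q [qI ->]]] := complete_reducibility haar1 p.
rewrite Phi_sum !chi_sum; apply: fusion_graph_sum => i; exact: fusion_graph_irr.
Qed.

Lemma Phi_triv : Phi (triv G1) = triv G2.
Proof. by apply: idempotent_triv; rewrite -Phi_tens tens_triv. Qed.

Lemma fusion_graph1 : fusion_graph 1 1.
Proof. by rewrite -(chi_triv G1) -(chi_triv G2) -Phi_triv; exact: fusion_graph_chi. Qed.

Lemma fusion_graphM a b a' b' : fusion_graph a b -> fusion_graph a' b' ->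
  fusion_graph (a * a') (b * b').
Proof.
move=> ab ab'; move: a b ab; apply: fusion_graph_ind => [|k p a b pI IH].
  by rewrite !mul0r; exact: fusion_graph0.
rewrite !mulrDl -!scalerAl; apply: fusion_graphP IH => {a b}.
move: a' b' ab'; apply: fusion_graph_ind => [|l q a b qI IH].
  by rewrite !mulr0; exact: fusion_graph0.
rewrite !mulrDr -!scalerAr; apply: fusion_graphP IH.
by rewrite -!chi_tens -Phi_tens; exact: fusion_graph_chi.
Qed.

Lemma fusion_graph_haar a b : fusion_graph a b -> h1 a = h2 b.
Proof.
move: a b; apply: fusion_graph_ind => [|k p a b pI IH]; first by rewrite !linear0.
rewrite !linearP /= IH (haar_chi haar1 pI) (haar_chi haar2 (Phi_irr pI)).
by rewrite -Phi_triv (inj_eq Phi_inj).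
Qed.

Lemma fusion_graph_star a b : fusion_graph a b -> fusion_graph (star a) (star b).
Proof.
move: a b; apply: fusion_graph_ind => [|k p a b pI IH].
  by rewrite !star0; exact: fusion_graph0.
rewrite !starD !starZ; apply: fusion_graphP IH.
have [q [qI qE]] := conj_irr haar1 pI.
have [r [rI rE]] := conj_irr haar2 (Phi_irr qI).
suff -> : star (chi (Phi p)) = chi (Phi q) by rewrite -qE; exact: fusion_graph_chi.
(* With r conjugate to Phi q, this pairing is h2(chi_(Phi q) chi_(Phi p)) = h1(chi_q chi_p) =
   h1(chi_p^* chi_p) = 1, which forces r = Phi p. *)
have : h2 (star (chi r) * chi (Phi p)) = 1.
  rewrite rE starK -chi_tens -Phi_tens -(fusion_graph_haar (fusion_graph_chi _)).
  by rewrite chi_tens qE chi_orth// eqxx.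
rewrite chi_orth//; last exact: Phi_irr.
have [<- _|_ /eqP] := eqVneq r (Phi p); last by rewrite eq_sym oner_eq0.
by rewrite rE starK.
Qed.

Lemma fusion_graph_norm a b : fusion_graph a b -> norm_infty h1 a = norm_infty h2 b.
Proof.
have c1 a' b' : fusion_graph a' b' -> chars a'.
  move: a' b'; apply: fusion_graph_ind => [|k p a' b' pI IH]; first exact: lspan0.
  by apply: lspan_cons IH; exists p.
have c2 a' b' : fusion_graph a' b' -> chars b'.
  move: a' b'; apply: fusion_graph_ind => [|k p a' b' pI IH]; first exact: lspan0.
  by apply: lspan_cons IH; exists (Phi p) => //; exact: Phi_irr.
move=> ab; apply/eqP; rewrite eq_le; apply/andP; split.
  apply: (norm_infty_le haar1 haar2 fusion_graph1) ab => //.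
  - exact: fusion_graphM.
  - exact: fusion_graph_star.
  - exact: fusion_graph_haar.
apply: (norm_infty_le haar2 haar1 (J := fun b a => fusion_graph a b) fusion_graph1) ab => //.
- by move=> *; exact: fusion_graphM.
- by move=> *; exact: fusion_graph_star.
- by move=> *; apply/esym/fusion_graph_haar.
- by move=> b' a'; exact: c2.
- by move=> b' a'; exact: c1.
Qed.

Lemma norm_infty_Phi (E : set (Rep G1)) (c : Rep G1 -> R[i]) : E `<=` @Irr R G1 ->
  finite_set [set p | E p /\ c p != 0] ->
  norm_infty h1 (\sum_(p \in E) c p *: chi p) =
  norm_infty h2 (\sum_(p \in E) c p *: chi (Phi p)).
Proof.
move=> EI /finite_support_seq [s [_ ss sE]]; apply: fusion_graph_norm.
rewrite !sE big_seq [X in fusion_graph _ X]big_seq.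
elim/big_rec2: _ => [|p y x /ss [pE _] IH]; first exact: fusion_graph0.
by apply: fusion_graphP => //; exact/fusion_graph_irr/EI.
Qed.

End Fusion.

(** * The Fourier norm of a character *)
Section FourierNorm.
Context (R : realType).
Local Notation C := R[i].

(** For l > 0, (P - l)(P + l) = 0 with P + l invertible. This uniqueness is what determines [absmx],
    a choice among positive roots. *)
Lemma psdmx_sqrt_scalar n (P : 'M[C]_n) (l : C) : psdmx P -> 0 <= l ->
  P *m P = (l ^+ 2)%:M -> P = l%:M.
Proof.
move=> P0 l0 PP; have [l_eq0|l_neq0] := eqVneq l 0.
  have -> : P = 0.
    apply: adjmx_mul_eq0; rewrite (psdmx_herm P0) PP l_eq0 expr0n /=.
    by apply/matrixP => i j; rewrite !mxE mul0rn.
  by rewrite l_eq0; apply/matrixP => i j; rewrite !mxE mul0rn.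
have lgt0 : 0 < l by rewrite lt_neqAle eq_sym l_neq0.
have Pl : P + l%:M \in unitmx.
  rewrite -row_free_unit -kermx_eq0; apply/rowV0P => x /sub_kermxP xP.
  have := congr1 (fun M : 'rV[C]_n => (M *m x^t*) 0 0) xP.
  rewrite mul0mx [RHS]mxE mulmxDr mul_mx_scalar mulmxDl -scalemxAl mxE [X in _ + X]mxE.
  move=> /eqP; rewrite paddr_eq0 ?P0//; last first.
    by rewrite mulr_ge0// mxE sumr_ge0// => i _; rewrite !mxE mul_conjC_ge0.
  rewrite mulf_eq0 (negbTE l_neq0) => /andP[_ /eqP xx].
  have : x *m x^t* = 0 by apply/matrixP => i j; rewrite !ord1 xx mxE.
  by rewrite -{1}[x]trmxCK => /adjmx_mul_eq0 x0; rewrite -[x]trmxCK x0 adjmx0.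
apply/eqP; rewrite -subr_eq0 -[_ - _](mulmxK Pl); apply/eqP.
rewrite mulmxDr !mulmxBl PP mul_scalar_mx mul_mx_scalar -scalar_mxM -expr2.
by rewrite addrA subrK subrr mul0mx.
Qed.

Lemma absmx_scalar n (k : C) : absmx (k%:M : 'M[C]_n) = `|k|%:M.
Proof.
have kk : (k%:M : 'M[C]_n)^t* *m k%:M = (`|k| ^+ 2)%:M.
  by rewrite tr_scalar_mx map_scalar_mx -scalar_mxM normCK mulrC.
rewrite /absmx; case: xgetP => [P _ [P0]|H].
  by rewrite kk => PP; exact: (psdmx_sqrt_scalar P0 (normr_ge0 k) PP).
exfalso; apply: (H `|k|%:M); split; last by rewrite kk expr2 scalar_mxM.
move=> x; rewrite mul_mx_scalar -scalemxAl mxE mulr_ge0// mxE sumr_ge0// => i _.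
by rewrite !mxE mul_conjC_ge0.
Qed.

Context (G : cqg R) (h : {scalar G}) (haar : is_haar h).
Implicit Types p q : Rep G.

Let h_state : is_state h. Proof. by case: haar. Qed.

Lemma Qmx_spec p : Irr p -> is_Qmx h (u := repr p) (Qmx h p).
Proof.
move=> pI; have [Q HQ] := is_Qmx_ex haar pI.
by rewrite /Qmx; case: xgetP => [Q' _ //|/(_ Q)].
Qed.

Lemma Qmx_tr_gt0 p : Irr p -> 0 < \tr (Qmx h p).
Proof.
move=> pI; have [Q0 _ _ QE] := Qmx_spec pI.
rewrite lt_neqAle sumr_ge0 ?andbT => [|i _]; last exact: psdmx_diag.
rewrite eq_sym; apply/eqP => t0.
have /mxstar_mull/(_ (Ordinal (urep_dim_gt0 (repr p))) (Ordinal (urep_dim_gt0 (repr p)))) := urep_isometry (repr p).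
move/(congr1 h); rewrite eqxx h_state.1 linear_sum big1 => [/eqP|i _ /=].
  by rewrite eq_sym oner_eq0.
by rewrite QE t0 invr0 mulr0.
Qed.

Lemma haar_coef_chi p q i j : Irr p -> Irr q ->
  h (star ((repr p : urep G) i j) * chi q) =
  (p == q)%:R * invmx (Qmx h p) j i / \tr (Qmx h p).
Proof.
move=> pI qI; rewrite /chi /mxtrace mulr_sumr linear_sum /=.
have [<-|pq] := eqVneq p q; last first.
  rewrite !mul0r big1// => m _; apply: (haar_orth haar) => //.
  by apply: rep_neq; rewrite eq_sym.
have [_ _ _ QE] := Qmx_spec pI.
rewrite (bigD1 j)//= big1 ?addr0 => [|m mj]; first by rewrite QE eqxx.
by rewrite QE eq_sym (negbTE mj) !mul0r.
Qed.

(** The Fourier coefficient at p is a multiple of Q^-1, which the factor Q of the norm cancels: the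
    scalar matrix c_p / Tr Q remains. The quantum dimension Tr Q then drops out, and the trace of
    the identity leaves the classical dimension. *)
Lemma fourier_norm1_chars (s : seq (Rep G)) (c : Rep G -> R[i]) : uniq s ->
  (forall p, p \in s -> Irr p) ->
  fourier_norm1 h (\sum_(p <- s) c p *: chi p) =
  (\sum_(p <- s) (rep_dim p)%:R * complex.Re `|c p|)%:E.
Proof.
(* The Fourier norm runs over all of Irr(G), so the coefficients are extended by zero. *)
move=> us sI; pose d p := if p \in s then c p else 0.
have xE p : Irr p ->
    fourier h (\sum_(p <- s) c p *: chi p) p *m Qmx h p =
    (d p / \tr (Qmx h p))%:M.
  move=> pI; have [_ Qu _ _] := Qmx_spec pI.
  rewrite -[RHS]mul1mx -(mulVmx Qu) mul_mx_scalar scalemxAl; congr (_ *m _).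
  apply/matrixP => i j; rewrite !mxE mulr_sumr linear_sum /=.
  have e q : q \in s -> h (star ((repr p : urep G) j i) * (c q *: chi q)) =
      (p == q)%:R * c q * (invmx (Qmx h p) i j / \tr (Qmx h p)).
    by move=> /sI qI; rewrite -scalerAr stateZ haar_coef_chi//; ring.
  rewrite big_seq (eq_bigr _ e) -big_seq -mulr_suml mulrAC -mulrA; congr (_ * _).
  rewrite /d; have [ps|ps] := boolP (p \in s).
    rewrite (bigD1_seq p)//= eqxx mul1r big1 ?addr0// => q qp.
    by rewrite eq_sym (negbTE qp) mul0r.
  rewrite big_seq big1// => q qs; have [e'|] := eqVneq p q; last by rewrite mul0r.
  by rewrite -e' (negbTE ps) in qs.
have tE p : Irr p ->
    complex.Re (\tr (Qmx h p) * \tr (absmx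
      (fourier h (\sum_(p <- s) c p *: chi p) p *m Qmx h p))) =
    (rep_dim p)%:R * complex.Re `|d p|.
  move=> pI; rewrite xE// absmx_scalar mxtrace_scalar -[_ *+ rep_dim p]mulr_natl.
  have t0 := Qmx_tr_gt0 pI.
  rewrite normrM normfV (gtr0_norm t0) mulrCA [X in _ * X]mulrCA mulfV ?gt_eqF// mulr1.
  have [r ->] : exists r, `|d p| = r%:C%C.
    by exists (complex.Re `|d p|); rewrite -ge0_Re.
  by rewrite -(rmorph_nat (real_complex R)) -rmorphM.
rewrite /fourier_norm1.
rewrite (_ : \esum_(p in _) _ = \esum_(p in @Irr R G `&` [set` s])
    ((rep_dim p)%:R * complex.Re `|c p|)%:E); last first.
  rewrite esum_mkcondr; apply: eq_esum => p pI; rewrite tE// mem_setE /d.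
  by case: ifP => // _; rewrite normr0 mulr0.
have -> : @Irr R G `&` [set` s] = [set` s] by apply/setIidPr => p /sI.
rewrite esum_fset; first by rewrite -fsbig_seq// sumEFin.
  by apply/finite_seqP; exists s.
by move=> p _; rewrite lee_fin mulr_ge0 ?ler0n ?Re_normr_ge0.
Qed.

End FourierNorm.

(** * Equality of the norms and transfer of central Sidon sets *)

Theorem proposition5p7 (R : realType) (G1 G2 : cqg R)
    (h1 : {scalar G1}) (h2 : {scalar G2})
    (haar1 : is_haar h1) (haar2 : is_haar h2)
    (Phi : Rep G1 -> Rep G2)
    (Phi_inj : injective Phi)
    (Phi_irr : forall p, Irr p -> Irr (Phi p))
    (Phi_tens : forall p q : Rep G1,
       Phi (rep_tens p q) = rep_tens (Phi p) (Phi q))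
    (Phi_sum : forall (n : nat) (p : 'I_n.+1 -> Rep G1),
       Phi (rep_sum p) = rep_sum (fun i => Phi (p i))) :
  (forall c : Rep G1 -> R[i],
     finite_set [set p | Irr p /\ c p != 0] ->
     norm_infty h1 (\sum_(p \in @Irr R G1) c p *: chi p) =
     norm_infty h2 (\sum_(p \in @Irr R G1) c p *: chi (Phi p))) /\
  (forall E : set (Rep G1),
     central_sidon h1 E ->
     (exists2 C : R, 0 < C &
        forall p, E p -> (rep_dim (Phi p))%:R <= C * (rep_dim p)%:R) ->
     central_sidon h2 (Phi @` E)).
Proof.
have nPhi := norm_infty_Phi haar1 haar2 Phi_inj Phi_irr Phi_tens Phi_sum.
split=> [c|E [EI [K K0 EK]] [C C0 CE]]; first exact: nPhi.
have inj_set (A : set (Rep G1)) : set_inj A Phi by move=> p q _ _ /Phi_inj.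
split=> [_ [p pE <-]|]; first exact/Phi_irr/EI.
exists (C * K) => [|c' fc']; first by rewrite mulr_gt0.
(* Coefficients on the image of [E] pull back along [Phi]; injectivity keeps the support finite and
   matches the sums term by term. *)
pose c p := c' (Phi p).
have fc : finite_set [set p | E p /\ c p != 0].
  apply: (@sub_finite_set _ _ (Phi @^-1` [set q | (Phi @` E) q /\ c' q != 0])).
    by move=> p [pE cp]; split=> //; exists p.
  by apply: finite_preimage => // p q _ _ /Phi_inj.
have sumE : \sum_(q \in Phi @` E) c' q *: chi q =
    \sum_(p \in E) c p *: chi (Phi p) :> G2.
  by apply: fsbig_image; exact: inj_set.
have [s [us ss sE]] := finite_support_seq fc.
have sI p : p \in s -> Irr p by move=> /ss [/EI].
have := EK c fc; rewrite sumE -nPhi// !sE.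
rewrite (fourier_norm1_chars haar1 c us sI).
have -> : \sum_(p <- s) c p *: chi (Phi p) =
    \sum_(q <- map Phi s) c' q *: chi q :> G2 by rewrite big_map.
rewrite (fourier_norm1_chars haar2); last 2 first.
- by rewrite map_inj_uniq.
- by move=> _ /mapP [p /sI pI ->]; exact: Phi_irr.
rewrite big_map => le.
have C0e : (0 <= C%:E)%E by rewrite lee_fin ltW.
have := lee_wpmul2l C0e le; rewrite muleA -EFinM; apply: le_trans.
rewrite lee_fin mulr_sumr big_seq [leRHS]big_seq; apply: ler_sum => p /ss [pE _].
by rewrite mulrA ler_wpM2r ?CE ?Re_normr_ge0.
Qed.
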